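(* Let $\Phi$ denote the standard normal CDF and let $\eta_0 := 2\left(1-\Phi(\sqrt{2\log 2})\right)\approx 0.239$. Let $\epsilon>0$ and $\eta<\eta_0-\epsilon$, and let $X\in\mathbb{R}^{m\times n}$ have i.i.d. $N(0,1)$ entries with $m> C\frac{n}{\epsilon^2}$ for a sufficiently large absolute constant $C$. Then with probability $1-e^{-\Omega(\epsilon^2 m)}$ the matrix $X$ has the following property: for any $w^*\in\mathbb{R}^n$, any $\zeta\in\mathbb{R}^m$ with $\|\zeta\|_0\leq\eta m$, any $d\in\mathbb{R}^m$, and $y=Xw^*+d+\zeta$, the estimator \[ \widehat{w} := \operatorname{argmin}_{w\in\mathbb{R}^n}\|y-Xw\|_1 \] satisfies \[ \|\widehat{w}-w^*\|_2 \leq O\left(\frac{\|d\|_1}{\epsilon m}\right), \] where the constant in $O(\cdot)$ is absolute.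
   Context: $\|\zeta\|_0$ denotes the number of nonzero entries of $\zeta$. The vector $\zeta$ represents adversarial sparse corruptions and $d$ is arbitrary dense noise. *)

(* Defs.v *)
From HB Require Import structures.
From mathcomp Require Import all_boot all_order all_algebra.
From mathcomp Require Import all_classical all_reals all_analysis.
Set Implicit Arguments. Unset Strict Implicit. Unset Printing Implicit Defensive.
Import Order.TTheory GRing.Theory Num.Theory.
Local Open Scope classical_set_scope.
Local Open Scope ring_scope.

Definition Phi {R : realType} (x : R) : R :=
  fine (normal_prob (0:R) 1 `]-oo, x]).

Definition eta0 {R : realType} : R :=
  2 * (1 - Phi (Num.sqrt (2 * ln 2))).

Definition l1norm {R : realType} {k : nat} (v : 'cV[R]_k) : R :=
  \sum_(i < k) `|v i 0|.
Definition l2norm {R : realType} {k : nat} (v : 'cV[R]_k) : R :=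
  Num.sqrt (\sum_(i < k) v i 0 ^+ 2).
Definition l0norm {R : realType} {k : nat} (v : 'cV[R]_k) : nat :=
  #|[set i : 'I_k | v i 0 != 0]|.

Definition is_l1_argmin {R : realType} {m n : nat}
    (A : 'M[R]_(m, n)) (y : 'cV[R]_m) (w : 'cV[R]_n) : Prop :=
  forall w' : 'cV[R]_n, l1norm (y - A *m w) <= l1norm (y - A *m w').

Definition robust_l1_property {R : realType} {m n : nat}
    (A : 'M[R]_(m, n)) (eta eps K : R) : Prop :=
  forall (wstar : 'cV[R]_n) (zeta dv : 'cV[R]_m),
    (l0norm zeta)%:R <= eta * m%:R ->
    forall what : 'cV[R]_n,
      is_l1_argmin A (A *m wstar + dv + zeta) what ->
      l2norm (what - wstar) <= K * l1norm dv / (eps * m%:R).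

(* The random variables X i j (i < m, j < n) are i.i.d. N(0,1):
   each has law N(0,1), and they are mutually independent
   (product rule for every choice of Borel sets; taking some sets equal
    to setT yields the product rule for every subfamily). *)
Definition iid_std_normal_matrix {d : measure_display} {T : measurableType d}
    {R : realType} (P : probability T R) {m n : nat}
    (X : 'I_m -> 'I_n -> {RV P >-> R}) : Prop :=
  (forall i j (B : set R), measurable B ->
      P (X i j @^-1` B) = normal_prob (0:R) 1 B) /\
  (forall B : 'I_m -> 'I_n -> set R, (forall i j, measurable (B i j)) ->
      P [set t | forall i j, B i j (X i j t)] =
      (\prod_(i < m) \prod_(j < n) P (X i j @^-1` B i j))%E).

(* Main.v *)
Require Import Defs.
From HB Require Import structures.
From mathcomp Require Import all_boot all_order all_algebra.
From mathcomp Require Import all_classical all_reals all_analysis.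
From mathcomp Require Import measurable_realfun ring lra.
Import Order.TTheory GRing.Theory Num.Theory.
Import numFieldNormedType.Exports.
Local Open Scope classical_set_scope.
Local Open Scope ring_scope.

(* Put t = sqrt(2 log 2) and phi(x) = min(|x|, 2t - |x|), which is 1-Lipschitz with
   phi(0) = 0. If zeta has at most eta m nonzero entries, the l1 mass of a vector v
   off the support of zeta exceeds its mass on the support by at least
   sum_i phi(v_i) - 2 t eta m, and E phi(N(0,1)) = 2 t eta0 exactly, because the
   normal density at t is half its value at 0. So it suffices that
   sum_i phi(<X_i, u>) >= m (2 t eta0 - t eps) uniformly over unit vectors u;
   optimality of the l1 minimiser does the rest.

   The uniform bound loses no logarithm because it comes from one exponential
   moment. By Jensen's inequality and the Ledoux-Talagrand contraction principle,
   applied row by row, E exp max_u sum_i a (E phi - phi(<X_i, u>)) / 2 is at most the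
   largest E exp max_u a sum_i s_i <X_i, u> over signs s_i. The latter is at most
   exp(a^2 m) 2^(n/2), since a sqrt(m) <G, u> <= a^2 m + |G|^2 / 4 for the standard
   Gaussian vector G = sum_i s_i X_i / sqrt(m). Chernoff's bound concludes, u ranging
   over finitely many and then over all normalised rational vectors. *)

Set Implicit Arguments.
Unset Strict Implicit.
Unset Printing Implicit Defensive.

(** * Gaussian integrals on the line *)

Lemma integral_cst_probability (d : measure_display) (T : measurableType d)
    (R : realType) (P : probability T R) (x : \bar R) : (\int[P]__ x = x)%E.
Proof. by rewrite integral_cst// [X in (_ * X)%E]probability_setT mule1. Qed.

Section normal_distribution.
Context {R : realType}.
Local Notation mu := (@lebesgue_measure R).
Local Notation N01 := (normal_prob (0 : R) 1).
Implicit Types (a b k m s t x z : R) (f : R -> \bar R).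

Lemma measurable_EFin_normal_pdf m s (D : set R) :
  measurable_fun D (fun x => (normal_pdf m s x)%:E).
Proof. by apply/measurable_EFinP/measurable_funTS; exact: measurable_normal_pdf. Qed.

Lemma normal_pdfN m s : normal_pdf m (- s) = normal_pdf m s.
Proof.
apply/funext => x; rewrite /normal_pdf oppr_eq0.
by rewrite /normal_peak /normal_fun sqrrN.
Qed.

Lemma ge0_integral_normal_prob m s f :
  measurable_fun [set: R] f -> (forall x, 0 <= f x)%E ->
  (\int[normal_prob m s]_x f x = \int[mu]_x (f x * (normal_pdf m s x)%:E))%E.
Proof.
move=> mf f0; have dom := @normal_prob_dominates R m s.
have mpdf := @measurable_EFin_normal_pdf m s [set: R].
have idensity := Radon_Nikodym_SigmaFinite.f_integrable dom.
rewrite -(Radon_Nikodym_SigmaFinite.change_of_variables dom)//.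
apply: ae_eq_integral => //.
- by apply: emeasurable_funM => //; exact: measurable_int idensity.
- exact: emeasurable_funM.
- apply: ae_eqe_mul2l; apply: integral_ae_eq => // E _ mE.
  by rewrite -Radon_Nikodym_SigmaFinite.f_integral.
Qed.

Let affine k b : measurableTypeR R -> measurableTypeR R := fun x => k * x + b.

Let measurable_affine k b : measurable_fun [set: measurableTypeR R] (affine k b).
Proof. by apply: measurable_funD => //; exact: measurable_funM. Qed.

Lemma lebesgue_measure_affine k b (A : set R) : k != 0 -> measurable A ->
  mu A = (`|k|%:E * mu ((fun x => k * x + b)%R @^-1` A))%E.
Proof.
move=> k0 mA; apply: (@lebesgue_measure_unique _
  (mscale (NngNum (normr_ge0 k)) (pushforward mu (affine k b)))) => //= _ [[u v]] _ <-.
rewrite /mscale/= /pushforward/= /affine.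
have [kneg|kpos|keq] := ltgtP k 0; last by rewrite keq eqxx in k0.
- have -> : affine k b @^-1` `]u, v]%classic = `[(v - b) / k, (u - b) / k[%classic.
    apply/seteqP; split => x /=;
      by rewrite !in_itv/= ler_ndivrMr// ltr_ndivlMr// lerBrDr ltrBlDr andbC mulrC.
  rewrite !lebesgue_measure_itv/= !lte_fin ltr_nM2r ?invr_lt0// ltrD2r ltr0_norm//.
  case: ifP => _; last by rewrite mule0.
  by rewrite -EFinB -EFinM; congr EFin; field.
- have -> : affine k b @^-1` `]u, v]%classic = `](u - b) / k, (v - b) / k]%classic.
    apply/seteqP; split => x /=;
      by rewrite !in_itv/= ler_pdivlMr// ltr_pdivrMr// lerBrDr ltrBlDr mulrC.
  rewrite !lebesgue_measure_itv/= !lte_fin ltr_pM2r ?invr_gt0// ltrD2r gtr0_norm//.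
  case: ifP => _; last by rewrite mule0.
  by rewrite -EFinB -EFinM; congr EFin; field.
Qed.

Lemma ge0_integral_affine k b f : k != 0 ->
  measurable_fun [set: R] f -> (forall x, 0 <= f x)%E ->
  (\int[mu]_x f x = `|k|%:E * \int[mu]_x f (k * x + b)%R)%E.
Proof.
move=> k0 mf f0; have mg := measurable_affine k b.
rewrite -[in RHS](ge0_integral_pushforward mg mu measurableT)//.
rewrite -(ge0_integral_mscale _ _ (NngNum (normr_ge0 k)))//.
by apply: eq_measure_integral => /= A mA _; exact: lebesgue_measure_affine.
Qed.

Lemma normal_pdf_affine k b x : k != 0 ->
  `|k| * normal_pdf b k (k * x + b) = normal_pdf 0 1 x.
Proof.
move=> k0; rewrite !normal_pdfE ?oner_neq0// mulrA; congr (_ * _).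
  rewrite /normal_peak expr1n mul1r -[in LHS]mulrnAr sqrtrM ?sqr_ge0// sqrtr_sqr.
  by rewrite invfM mulrA divff ?mul1r// normr_eq0.
rewrite /normal_fun addrK subr0 expr1n exprMn; congr expR.
by rewrite -[k ^+ 2 *+ 2]mulr_natr; field.
Qed.

Lemma ge0_integral_normal01_affine k b f : k != 0 ->
  measurable_fun [set: R] f -> (forall x, 0 <= f x)%E ->
  (\int[N01]_x f (k * x + b)%R = \int[normal_prob b k]_x f x)%E.
Proof.
move=> k0 mf f0.
have mfa : measurable_fun [set: R] (fun x => f (k * x + b)).
  by apply: (measurableT_comp mf); exact: measurable_affine.
pose h x := (f x * (normal_pdf b k x)%:E)%E.
have h0 x : (0 <= h x)%E by rewrite mule_ge0// lee_fin normal_pdf_ge0.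
have mh : measurable_fun [set: R] h.
  by apply: emeasurable_funM => //; exact: measurable_EFin_normal_pdf.
rewrite (ge0_integral_normal_prob b k mf f0).
rewrite (ge0_integral_normal_prob 0 1 mfa (fun=> f0 _)).
rewrite (ge0_integral_affine b k0 mh h0) -ge0_integralZl//; last first.
  by apply: (measurableT_comp mh); exact: measurable_affine.
by apply: eq_integral => x _; rewrite muleCA -EFinM normal_pdf_affine.
Qed.

(* Completing the square: the law of x ~ N(0, 1) and z | x ~ N(a x, s^2), read
   backwards as z ~ N(0, s^2 + a^2) and x | z ~ N(a z / r^2, s^2 / r^2). *)
Lemma normal_pdf_mixture a s x z (r := Num.sqrt (s ^+ 2 + a ^+ 2)) : s != 0 ->
  normal_pdf 0 1 x * normal_pdf (a * x) s z =
  normal_pdf 0 r z * normal_pdf (a * z / r ^+ 2) (s / r) x.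
Proof.
move=> s0; have s20 : 0 < s ^+ 2 by rewrite exprn_even_gt0.
have q0 : 0 < s ^+ 2 + a ^+ 2 by rewrite ltr_wpDr ?sqr_ge0.
have r2 : r ^+ 2 = s ^+ 2 + a ^+ 2 by rewrite sqr_sqrtr// ltW.
have r0 : r != 0 by rewrite sqrtr_eq0 -ltNge.
rewrite !normal_pdfE ?oner_neq0 ?mulf_neq0 ?invr_eq0//.
rewrite mulrACA [RHS]mulrACA; congr (_ * _).
  have var0 (u : R) : 0 <= u ^+ 2 * pi *+ 2 by rewrite mulrn_wge0// mulr_ge0 ?pi_ge0 ?sqr_ge0.
  rewrite /normal_peak -!invfM -!sqrtrM ?var0//.
  congr (Num.sqrt _)^-1; rewrite expr_div_n r2 !mulr2n; field.
  by rewrite gt_eqF.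
rewrite /normal_fun -!expRD; congr expR.
rewrite r2 expr_div_n r2 !mulr2n; field.
by rewrite !gt_eqF// addr_gt0.
Qed.

Lemma ge0_integral_normal_mixture a s f : s != 0 ->
  measurable_fun [set: R] f -> (forall x, 0 <= f x)%E ->
  (\int[N01]_x \int[normal_prob (a * x)%R s]_z f z =
   \int[normal_prob 0%R (Num.sqrt (s ^+ 2 + a ^+ 2))%R]_z f z)%E.
Proof.
move=> s0 mf f0; set r := Num.sqrt _.
pose g (xz : R * R) := (f xz.2 * (normal_pdf (a * xz.1) s xz.2)%:E)%E.
have g0 xz : (0 <= g xz)%E by rewrite mule_ge0// lee_fin normal_pdf_ge0.
have mg : measurable_fun [set: R * R] g.
  apply: emeasurable_funM; first exact: measurableT_comp.
  apply/measurable_EFinP; under eq_fun do rewrite normal_pdfE// /normal_fun.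
  apply: measurable_funM => //; apply: measurableT_comp => //.
  apply: measurable_funM => //; apply: measurableT_comp => //; apply: measurable_funX.
  by apply: measurable_funB => //; exact: measurable_funM.
pose joint (xz : R * R) := (g xz * (normal_pdf 0 1 xz.1)%:E)%E.
have joint0 xz : (0 <= joint xz)%E by rewrite mule_ge0// lee_fin normal_pdf_ge0.
have mjoint : measurable_fun [set: R * R] joint.
  apply: emeasurable_funM => //.
  by apply: (measurableT_comp (@measurable_EFin_normal_pdf 0 1 setT)); exact: measurable_fst.
have mG := @measurable_fun_fubini_tonelli_F _ _ _ _ R mu _ mg g0.
have G0 x : (0 <= fubini_F mu g x)%E by apply: integral_ge0 => z _; exact: g0.
transitivity (\int[mu]_x \int[mu]_z joint (x, z))%E.
  under eq_integral do rewrite ge0_integral_normal_prob//.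
  rewrite (ge0_integral_normal_prob 0 1 mG G0).
  apply: eq_integral => x _; rewrite -ge0_integralZr//.
  - exact: (measurableT_comp mg (measurable_pair1 x)).
  - by rewrite lee_fin normal_pdf_ge0.
rewrite fubini_tonelli// ge0_integral_normal_prob//; apply: eq_integral => z _.
under eq_integral => x _ do
  rewrite /joint /g/= -muleA -EFinM mulrC normal_pdf_mixture// EFinM muleA.
rewrite ge0_integralZl//.
- by rewrite integral_normal_pdf mule1.
- exact: measurable_EFin_normal_pdf.
- by move=> x _; rewrite lee_fin normal_pdf_ge0.
- by rewrite mule_ge0// lee_fin normal_pdf_ge0.
Qed.

(* Stated by rescaling N(0, 1), as [normal_prob 0 0] is the uniform law on [0, 1]. *)
Lemma ge0_integral_normal01_rotation a s f :
  measurable_fun [set: R] f -> (forall x, 0 <= f x)%E ->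
  (\int[N01]_x \int[N01]_y f (a * x + s * y)%R =
   \int[N01]_z f (Num.sqrt (s ^+ 2 + a ^+ 2) * z)%R)%E.
Proof.
move=> mf f0; have scaled k : k != 0 ->
    (\int[N01]_x f (k * x)%R = \int[normal_prob 0 k]_x f x)%E.
  move=> k0; under eq_integral do rewrite -[X in f X]addr0.
  exact: ge0_integral_normal01_affine.
have [->|s0] := eqVneq s 0.
  rewrite expr0n/= add0r sqrtr_sqr.
  transitivity (\int[N01]_x f (a * x)%R)%E.
    apply: eq_integral => x _; under eq_integral do rewrite mul0r addr0.
    by rewrite integral_cst_probability.
  have [->|a0] := eqVneq a 0; first by rewrite normr0.
  have na0 : `|a| != 0 by rewrite normr_eq0.
  rewrite (scaled _ a0) (scaled _ na0); have [_|_] := ger0P a; first by [].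
  by rewrite /normal_prob normal_pdfN.
have r0 : Num.sqrt (s ^+ 2 + a ^+ 2) != 0.
  by rewrite sqrtr_eq0 -ltNge ltr_wpDr ?sqr_ge0// exprn_even_gt0.
under eq_integral => x _ do
  (under eq_integral do rewrite addrC; rewrite ge0_integral_normal01_affine//).
by rewrite (ge0_integral_normal_mixture _ s0 mf f0) (scaled _ r0).
Qed.

Lemma integral_normal01_expR_sqr k : k < 2^-1 ->
  (\int[N01]_x (expR (k * x ^+ 2))%:E = (Num.sqrt (1 - 2 * k))^-1%:E)%E.
Proof.
move=> k12; set v := 1 - 2 * k; have v0 : 0 < v by rewrite /v; lra.
have sv0 : 0 < Num.sqrt v by rewrite sqrtr_gt0.
rewrite ge0_integral_normal_prob; first last.
- by move=> x; rewrite lee_fin expR_ge0.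
- by apply/measurable_EFinP; apply: measurableT_comp => //; exact: measurable_funM.
transitivity (\int[mu]_x ((Num.sqrt v)^-1%:E * (normal_pdf 0 (Num.sqrt v)^-1 x)%:E))%E.
  apply: eq_integral => x _; rewrite -!EFinM; congr EFin.
  rewrite !normal_pdfE ?oner_neq0 ?invr_eq0 ?gt_eqF// mulrCA [RHS]mulrA; congr (_ * _).
    rewrite /normal_peak expr1n mul1r -[in RHS]mulrnAr sqrtrM ?sqr_ge0// sqrtr_sqr.
    by rewrite gtr0_norm ?invr_gt0// invfM mulrA divff ?mul1r// invr_eq0 gt_eqF.
  rewrite /normal_fun -expRD subr0 exprVn sqr_sqrtr ?(ltW v0)// expr1n !mulr2n.
  by congr expR; rewrite /v; field; rewrite -/v gt_eqF.
rewrite ge0_integralZl//.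
- by rewrite integral_normal_pdf mule1.
- exact: measurable_EFin_normal_pdf.
- by move=> x _; rewrite lee_fin normal_pdf_ge0.
Qed.

Lemma integral_normal01_pdf_tail t :
  (\int[mu]_(x in `[t, +oo[) (normal_pdf 0 1 x)%:E = (1 - Phi t)%:E)%E.
Proof.
rewrite -integral_itv_obnd_cbnd; last exact: measurable_EFin_normal_pdf.
rewrite -[LHS]/(N01 `]t, +oo[) -setCitvl probability_setC// /Phi EFinB fineK//.
exact: fin_num_measure.
Qed.

Lemma integral_normal01_pdf_tail_id t : 0 <= t ->
  (\int[mu]_(x in `[t, +oo[) (x * normal_pdf 0 1 x)%:E = (normal_pdf 0 1 t)%:E)%E.
Proof.
move=> t0; have pdfE : normal_pdf 0 1 =
    fun x : R => normal_peak 1 * expR (- (x ^+ 2 / (1 ^+ 2 *+ 2))).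
  by apply/funext => x; rewrite normal_pdfE ?oner_neq0// /normal_fun subr0 mulNr.
have dF x : is_derive x 1 (fun x => - normal_pdf 0 1 x) (x * normal_pdf 0 1 x).
  rewrite pdfE; apply: is_derive_eq.
  rewrite /GRing.scale/= !(addr0, mulr1, mulr0, expr1n).
  by field.
have cpdf : continuous (normal_pdf 0 1 : R -> R) by exact: continuous_normal_pdf.
rewrite (@ge0_continuous_FTC2y _ _ (fun x => - normal_pdf 0 1 x) t 0).
- by rewrite -EFinB sub0r opprK.
- by move=> x tx; rewrite mulr_ge0 ?normal_pdf_ge0// (le_trans t0).
- apply: continuous_subspaceT => x; apply: cvgM; [exact: cvg_id|exact: cpdf].
- rewrite -[X in _ --> X]oppr0; apply: cvgN; rewrite pdfE.
  rewrite -[X in _ --> X](mulr0 (normal_peak 1)); apply: cvgM; first exact: cvg_cst.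
  apply: (cvg_comp (fun x : R => x ^+ 2 / (1 ^+ 2 *+ 2)) (fun x => expR (- x))).
    by apply: gt0_cvgMly; [rewrite invr_gt0 expr1n|exact: cvgr_expr2].
  exact: cvgr_expR.
- by move=> x _; exact: @ex_derive.
- by apply: cvgN; apply: cvg_at_right_filter; exact: cpdf.
- by move=> x _; rewrite derive1E; exact: derive_val.
Qed.

Lemma integral_normal01_excess t : 0 <= t ->
  (\int[N01]_x (Num.max (x - t) 0)%:E =
   (normal_pdf 0 1 t - t * (1 - Phi t))%:E)%E.
Proof.
move=> t0; have mexcess : measurable_fun [set: R] (fun x => (Num.max (x - t) 0)%:E).
  by apply/measurable_EFinP/measurable_maxr => //; exact: measurable_funB.
have excess0 x : (0 <= (Num.max (x - t) 0)%:E)%E by rewrite lee_fin le_max lexx orbT.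
rewrite (ge0_integral_normal_prob 0 1 mexcess excess0).
transitivity (\int[mu]_(x in `[t, +oo[) ((x - t) * normal_pdf 0 1 x)%:E)%E.
  rewrite [RHS]integral_mkcond; apply: eq_integral => x _.
  rewrite patchE mem_setE in_itv/= andbT; case: ifPn => tx.
    by rewrite max_l ?subr_ge0.
  by rewrite max_r ?mul0e// subr_le0 ltW// ltNge.
have mpdf := @measurable_EFin_normal_pdf 0 1 `[t, +oo[%classic.
rewrite EFinB -(integral_normal01_pdf_tail_id t0).
under [X in _ = (X - _)%E]eq_integral do rewrite -[X in X * _](subrK t) mulrDl EFinD.
rewrite ge0_integralD//; first last.
- by apply/measurable_EFinP/measurable_funM => //; exact/measurable_EFinP.
- by move=> x _; rewrite lee_fin mulr_ge0// normal_pdf_ge0.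
- apply/measurable_EFinP/measurable_funM; last exact/measurable_EFinP.
  exact: measurable_funB.
- move=> x; rewrite /= in_itv/= andbT => tx.
  by rewrite lee_fin mulr_ge0// ?subr_ge0// normal_pdf_ge0.
under [X in (_ + X - _)%E]eq_integral do rewrite EFinM.
rewrite ge0_integralZl//; last by move=> x _; rewrite lee_fin normal_pdf_ge0.
by rewrite integral_normal01_pdf_tail -EFinM addeK.
Qed.

Lemma integral_normal01_excess_norm t : 0 <= t ->
  (\int[N01]_x (Num.max (`|x| - t) 0)%:E =
   (2 * (normal_pdf 0 1 t - t * (1 - Phi t)))%:E)%E.
Proof.
move=> t0; pose excess x := (Num.max (x - t) 0)%:E.
have mexcess : measurable_fun [set: R] excess.
  by apply/measurable_EFinP/measurable_maxr => //; exact: measurable_funB.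
have excess0 x : (0 <= excess x)%E by rewrite lee_fin le_max lexx orbT.
transitivity (\int[N01]_x (excess x + excess (- x)%R))%E.
  apply: eq_integral => x _; rewrite -EFinD; congr EFin.
  have [x0|x0] := lerP 0 x.
    by rewrite ger0_norm// (@max_r _ _ (- x - t)) ?addr0//; lra.
  by rewrite ltr0_norm// (@max_r _ _ (x - t)) ?add0r//; lra.
rewrite ge0_integralD//; last exact: measurableT_comp.
under [X in (_ + X)%E]eq_integral do rewrite -mulN1r -[X in excess X]addr0.
rewrite (ge0_integral_normal01_affine _ _ mexcess excess0) ?oppr_eq0//.
rewrite /normal_prob normal_pdfN integral_normal01_excess// -EFinD.
by congr EFin; ring.
Qed.

Lemma integral_normal01_norm :
  (\int[N01]_x `|x|%:E = (2 * normal_pdf 0 1 0)%:E)%E.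
Proof.
have := integral_normal01_excess_norm (lexx 0); rewrite mul0r subr0 => <-.
by apply: eq_integral => x _; rewrite subr0 max_l.
Qed.

Lemma integrable_normal01_id : N01.-integrable [set: R] EFin.
Proof.
apply/integrableP; split=> //; under eq_integral do rewrite /=.
by rewrite integral_normal01_norm ltry.
Qed.

End normal_distribution.

(** * Independence of sub-families *)

Lemma measurable_sum_seq (d : measure_display) (T : measurableType d) (R : realType)
    (D : set T) (I : eqType) (s : seq I) (h : I -> T -> R) :
  (forall i, i \in s -> measurable_fun D (h i)) ->
  measurable_fun D (fun x => \sum_(i <- s) h i x).
Proof.
move=> mh; under eq_fun do rewrite big_seq big_mkcond.
by apply: measurable_sum => i; case: (boolP (i \in s)) => [/mh|_].
Qed.

Lemma g_sigma_algebra_product_rule (d : measure_display) (T : measurableType d)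
    (R : realType) (P : probability T R) (G : set (set T)) (A D : set T) :
  G `<=` measurable -> G setT -> setI_closed G -> measurable D ->
  (forall E, G E -> P (E `&` D) = (P E * P D)%E) ->
  <<s G >> A -> P (A `&` D) = (P A * P D)%E.
Proof.
move=> mG GT GI mD prodG sA.
have PD0 : 0 <= fine (P D) by rewrite fine_ge0.
have PDE : P D = (fine (P D))%:E by rewrite fineK// fin_num_measure.
have : mrestr P mD A = mscale (NngNum PD0) P A.
  apply: (@g_sigma_algebra_measure_unique _ R T G mG (fun=> setT) (fun=> GT) _
    (mrestr P mD) (mscale (NngNum PD0) P) GI _ _ _ sA).
  - by rewrite bigcup_const//; exists 0%N.
  - by move=> E GE; rewrite /= /mrestr /mscale/= prodG// PDE muleC.
  - by move=> _; rewrite /= /mrestr setTI -ge0_fin_numE// fin_num_measure.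
by rewrite /mrestr /mscale/= -PDE => ->; rewrite muleC.
Qed.

Section independence.
Context {d d' : measure_display} {T : measurableType d} {U : measurableType d'}
  {R : realType} (P : probability T R) (I : finType) (W : I -> {RV P >-> U}).

Definition mutually_independent := forall B : I -> set U,
  (forall i, measurable (B i)) ->
  P [set t | forall i, B i (W i t)] = (\prod_i P (W i @^-1` B i))%E.

Definition cylinders (J : pred I) : set (set T) :=
  [set E | exists B : I -> set U, [/\ forall i, measurable (B i),
     forall i, ~~ J i -> B i = setT & E = [set t | forall i, B i (W i t)]]].

(* T with the sigma-algebra generated by the [W i] such that [J i]. *)
Local Notation sigma_of J := (g_sigma_algebraType (cylinders J)).

Lemma setI_closed_cylinders (J : pred I) : setI_closed (cylinders J).
Proof.
move=> _ _ [B [mB BJ ->]] [C [mC CJ ->]].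
exists (fun i => B i `&` C i); split=> [i|i iJ|].
- exact: measurableI.
- by rewrite BJ// CJ// setIT.
- by apply/seteqP; split=> t; [move=> [Bt Ct] i|move=> BC; split=> i; have [] := BC i].
Qed.

Lemma cylindersT (J : pred I) : cylinders J setT.
Proof. by exists (fun=> setT); split=> //; apply/seteqP; split. Qed.

Lemma measurable_cylinders (J : pred I) : cylinders J `<=` measurable.
Proof.
move=> _ [B [mB _ ->]].
rewrite (_ : [set t | _] = \bigcap_(i in [set: I]) (W i @^-1` B i)); last first.
  by apply/seteqP; split=> t Bt i => [_|]; exact: Bt.
by apply: fin_bigcap_measurable => // i _; exact: measurable_funPTI.
Qed.

Lemma sigma_cylinders_measurable (J : pred I) (A : set T) :
  <<s cylinders J >> A -> measurable A.
Proof.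
by apply: smallest_sub; [exact: sigma_algebra_measurable|exact: measurable_cylinders].
Qed.

Lemma measurable_id_sigma_of (J : pred I) : measurable_fun [set: T] (id : T -> sigma_of J).
Proof. by move=> _ B sB; rewrite setTI; exact: sigma_cylinders_measurable sB. Qed.

Lemma measurable_fun_cylinders (J : pred I) (i : I) : J i ->
  measurable_fun [set: sigma_of J] (W i).
Proof.
move=> iJ _ B mB; rewrite setTI; apply: sub_sigma_algebra.
exists (fun j => if j == i then B else setT); split=> [j|j jJ|].
- by case: ifP.
- by case: ifPn jJ => // /eqP ->; rewrite iJ.
- apply/seteqP; split => t /=; first by move=> Bt j; case: ifPn => // /eqP ->.
  by move=> /(_ i); rewrite eqxx.
Qed.

Lemma measurable_fun_cylindersS (J K : pred I) (d'' : measure_display) (V : measurableType d'')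
    (f : T -> V) : (forall i, J i -> K i) ->
  measurable_fun [set: sigma_of J] f -> measurable_fun [set: sigma_of K] f.
Proof.
move=> JK mf _ B mB; have := mf measurableT B mB; rewrite !setTI.
apply: sub_sigma_algebra2 => _ [C [mC CJ ->]].
by exists C; split=> // i iK; apply: CJ; apply: contra iK; exact: JK.
Qed.

Lemma measurable_fun_cylindersW (J : pred I) (d'' : measure_display) (V : measurableType d'')
    (f : T -> V) :
  measurable_fun [set: sigma_of J] f -> measurable_fun [set: T] f.
Proof.
move=> mf _ B mB; have := mf measurableT B mB; rewrite !setTI.
exact: sigma_cylinders_measurable.
Qed.

Hypothesis indepW : mutually_independent.

Lemma product_rule_cylinders (J K : pred I) (A B : set T) :
  (forall i, J i -> ~~ K i) ->
  cylinders J A -> cylinders K B -> P (A `&` B) = (P A * P B)%E.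
Proof.
move=> JK [A' [mA AJ ->]] [B' [mB BK ->]].
have -> : [set t | forall i, A' i (W i t)] `&` [set t | forall i, B' i (W i t)] =
    [set t | forall i, (A' i `&` B' i) (W i t)].
  by apply/seteqP; split=> t; [move=> [At Bt] i|move=> AB; split=> i; have [] := AB i].
have mAB i : measurable (A' i `&` B' i) by exact: measurableI.
rewrite (indepW mA) (indepW mB) (indepW mAB) -big_split/=; apply: eq_bigr => i _.
have [iJ|iJ] := boolP (J i).
  by rewrite (BK i (JK i iJ)) setIT preimage_setT probability_setT mule1.
by rewrite (AJ i)// setTI preimage_setT probability_setT mul1e.
Qed.

Lemma product_rule_sigma (J K : pred I) (A B : set T) : (forall i, J i -> ~~ K i) ->
  <<s cylinders J >> A -> <<s cylinders K >> B -> P (A `&` B) = (P A * P B)%E.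
Proof.
move=> JK sA sB.
have product_rule L C D := @g_sigma_algebra_product_rule _ _ _ P (cylinders L) C D
  (@measurable_cylinders L) (cylindersT L) (@setI_closed_cylinders L).
apply: (product_rule J _ _ _ _ sA); first exact: sigma_cylinders_measurable sB.
move=> E cE; rewrite setIC muleC; apply: (product_rule K _ _ _ _ sB).
  exact: measurable_cylinders cE.
by move=> F cF; rewrite setIC muleC; exact: product_rule_cylinders cE cF.
Qed.

Lemma indep_fubini (J K : pred I) (F : sigma_of J * sigma_of K -> \bar R) :
  (forall i, J i -> ~~ K i) -> measurable_fun setT F -> (forall x, 0 <= F x)%E ->
  (\int[P]_t F (t, t) = \int[P]_t \int[P]_t' F (t, t'))%E.
Proof.
move=> JK mF F0.
pose idm (L : pred I) : {mfun T >-> sigma_of L} := HB.pack (id : T -> sigma_of L)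
   (isMeasurableFun.Build _ _ _ _ (id : T -> sigma_of L) (@measurable_id_sigma_of L)).
pose diag : T -> (sigma_of J * sigma_of K)%type := fun t => (t, t).
have mdiag : measurable_fun [set: T] diag.
  by apply: measurable_fun_pair; exact: measurable_id_sigma_of.
pose diagm : {mfun T >-> (sigma_of J * sigma_of K)%type} := HB.pack diag
   (isMeasurableFun.Build _ _ T (sigma_of J * sigma_of K)%type diag mdiag).
transitivity (\int[distribution P diagm]_z F z)%E.
  by rewrite ge0_integral_distribution.
transitivity (\int[distribution P (idm J) \x distribution P (idm K)]_z F z)%E.
  apply: eq_measure_integral => A mA _; apply/esym/product_measure_unique => //.
  by move=> B C mB mC; exact: (product_rule_sigma JK).
rewrite fubini_tonelli1//= /fubini_F ge0_integral_distribution//=; first last.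
- by move=> x; apply: integral_ge0.
- exact: measurable_fun_fubini_tonelli_F.
apply: eq_integral => t _; rewrite ge0_integral_distribution//=.
exact: measurableT_comp.
Qed.

Lemma indep_le_integral (J K : pred I) (F G : sigma_of J * sigma_of K -> \bar R) :
  (forall i, J i -> ~~ K i) ->
  measurable_fun setT F -> measurable_fun setT G ->
  (forall x, 0 <= F x)%E -> (forall x, 0 <= G x)%E ->
  (forall t, \int[P]_t' F (t, t') <= \int[P]_t' G (t, t'))%E ->
  (\int[P]_t F (t, t) <= \int[P]_t G (t, t))%E.
Proof.
move=> JK mF mG F0 G0 FG.
rewrite (indep_fubini JK mF F0) (indep_fubini JK mG G0).
have mpair : measurable_fun [set: T * T] (fun x => (x.1, x.2) : sigma_of J * sigma_of K).
  apply: measurable_fun_pair.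
    exact: (measurableT_comp (@measurable_id_sigma_of J) measurable_fst).
  exact: (measurableT_comp (@measurable_id_sigma_of K) measurable_snd).
have mint (H : sigma_of J * sigma_of K -> \bar R) : measurable_fun setT H ->
    (forall x, 0 <= H x)%E -> measurable_fun [set: T] (fun t => \int[P]_t' H (t, t'))%E.
  move=> mH H0; have mHpair := measurableT_comp mH mpair.
  exact: (@measurable_fun_fubini_tonelli_F _ _ _ _ R P _ mHpair (fun=> H0 _)).
by apply: ge0_le_integral => //; [move=> t _; apply: integral_ge0|exact: mint|exact: mint].
Qed.

Lemma integral_prod_indep (L : eqType) (f : I -> L) (s : seq L) (g : L -> T -> R) :
  uniq s -> (forall k, measurable_fun [set: sigma_of [pred i | f i == k]] (g k)) ->
  (forall k t, 0 <= g k t) ->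
  (\int[P]_t (\prod_(k <- s) g k t)%:E = \prod_(k <- s) \int[P]_t (g k t)%:E)%E.
Proof.
move=> + mg g0; elim: s => [_|k s IHs /= /andP[ks us]].
  under eq_integral do rewrite big_nil.
  by rewrite big_nil integral_cst_probability.
pose tail t := \prod_(l <- s) g l t.
have mtail : measurable_fun [set: sigma_of [pred i | f i \in s]] tail.
  apply: measurable_prod => l ls; apply: measurable_fun_cylindersS (mg l) => i /=.
  by move=> /eqP ->.
have tail0 t : 0 <= tail t by apply: prodr_ge0 => l _.
under eq_integral do rewrite big_cons.
rewrite (@indep_fubini [pred i | f i == k] [pred i | f i \in s]
  (fun x => (g k x.1 * tail x.2)%:E)); first last.
- by move=> x; rewrite lee_fin mulr_ge0.
- apply/measurable_EFinP/measurable_funM.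
    by apply: (measurableT_comp (mg k)); exact: measurable_fst.
  by apply: (measurableT_comp mtail); exact: measurable_snd.
- by move=> i /= /eqP ->.
rewrite big_cons -IHs//.
transitivity (\int[P]_t ((g k t)%:E * \int[P]_t' (tail t')%:E))%E.
  apply: eq_integral => t _ /=; under eq_integral do rewrite EFinM.
  rewrite ge0_integralZl//.
  - by apply/measurable_EFinP; exact: measurable_fun_cylindersW mtail.
  - by move=> t' _; rewrite lee_fin.
  - by rewrite lee_fin.
rewrite ge0_integralZr//.
- by apply/measurable_EFinP; exact: measurable_fun_cylindersW (mg k).
- by move=> t _; rewrite lee_fin.
- by apply: integral_ge0 => t _; rewrite lee_fin.
Qed.

End independence.

Section law.
Context {d d' : measure_display} {T : measurableType d} {U : measurableType d'}
  {R : realType} (P : probability T R) (nu : {measure set U -> \bar R}) (Y : T -> U).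
Hypothesis mY : measurable_fun [set: T] Y.
Hypothesis lawY : forall B, measurable B -> P (Y @^-1` B) = nu B.
Implicit Type f : U -> \bar R.

Lemma ge0_integral_law f : measurable_fun [set: U] f -> (forall x, 0 <= f x)%E ->
  (\int[P]_t f (Y t) = \int[nu]_x f x)%E.
Proof.
move=> mf f0; rewrite -[LHS](ge0_integral_pushforward mY P measurableT mf)//.
by apply: eq_measure_integral => B mB _; exact: lawY.
Qed.

Lemma integrable_law f : nu.-integrable [set: U] f ->
  P.-integrable [set: T] (fun t => f (Y t)).
Proof.
move=> /integrableP[mf foo]; apply/integrableP; split; first exact: measurableT_comp.
by rewrite (@ge0_integral_law (fun x => `|f x|)%E)//; exact: measurableT_comp.
Qed.

Lemma integral_law f : nu.-integrable [set: U] f ->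
  (\int[P]_t f (Y t) = \int[nu]_x f x)%E.
Proof.
move=> intf; have mf := measurable_int _ intf.
rewrite -[LHS](integral_pushforward mY mf (integrable_law intf) measurableT).
by apply: eq_measure_integral => B mB _; exact: lawY.
Qed.

End law.

Section gaussian_family.
Context {d : measure_display} {T : measurableType d} {R : realType}
  (P : probability T R) (I : finType) (W : I -> {RV P >-> R}).
Local Notation sigma_of J := (g_sigma_algebraType (cylinders W J)).
Local Notation N01 := (normal_prob (0 : R) 1).
Hypothesis indepW : mutually_independent W.
Hypothesis lawW : forall i (B : set R), measurable B -> P (W i @^-1` B) = N01 B.
Implicit Types (r : seq I) (a : I -> R).

Lemma measurable_lincomb (J : pred I) r a : {subset r <= J} ->
  measurable_fun [set: sigma_of J] (fun t => \sum_(i <- r) a i * W i t).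
Proof.
move=> rJ; apply: measurable_sum_seq => i /rJ Ji; apply: measurable_funM => //.
exact: measurable_fun_cylinders.
Qed.

Lemma ge0_integral_lincomb r a (f : R -> \bar R) : uniq r ->
  measurable_fun [set: R] f -> (forall x, 0 <= f x)%E ->
  (\int[P]_t f (\sum_(i <- r) a i * W i t)%R =
   \int[N01]_z f (Num.sqrt (\sum_(i <- r) a i ^+ 2) * z)%R)%E.
Proof.
elim: r f => [|i r IHr] f /=.
  move=> _ mf f0; rewrite big_nil sqrtr0.
  under eq_integral do rewrite big_nil.
  under [RHS]eq_integral do rewrite mul0r.
  by rewrite !integral_cst_probability.
move=> /andP[ir ur] mf f0; under eq_integral do rewrite big_cons.
rewrite (@indep_fubini _ _ _ _ _ _ _ _ indepW (pred1 i) (mem r)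
  (fun x => f (a i * W i x.1 + \sum_(j <- r) a j * W j x.2))); first last.
- by move=> x; exact: f0.
- apply: (measurableT_comp mf); apply: measurable_funD.
    apply: measurable_funM => //.
    apply: (@measurableT_comp _ _ _ _ _ _ (W i : sigma_of (pred1 i) -> R)); last first.
      exact: measurable_fst.
    by apply: measurable_fun_cylinders; rewrite /= eqxx.
  by apply: (measurableT_comp (measurable_lincomb a (fun j jr => jr))); exact: measurable_snd.
- by move=> j /eqP ->.
set s := Num.sqrt (\sum_(j <- r) a j ^+ 2).
transitivity (\int[P]_t \int[N01]_z f (a i * W i t + s * z)%R)%E.
  apply: eq_integral => t _ /=.
  by rewrite (IHr (fun x => f (a i * W i t + x)%R))//; apply: (measurableT_comp mf);
    exact: measurable_funD.
have mg : measurable_fun [set: R * R] (fun xz => f (a i * xz.1 + s * xz.2)%R).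
  by apply: (measurableT_comp mf); apply: measurable_funD; exact: measurable_funM.
have mG := @measurable_fun_fubini_tonelli_F _ _ _ _ R N01 _ mg (fun=> f0 _).
rewrite (ge0_integral_law (nu := N01) (measurable_funPT (W i)) (lawW i) mG); last first.
  by move=> x; apply: integral_ge0.
rewrite /fubini_F/= (ge0_integral_normal01_rotation (a i) s mf f0) sqr_sqrtr; last first.
  by apply: sumr_ge0 => j _; rewrite sqr_ge0.
by rewrite big_cons addrC.
Qed.

Lemma unit_lincomb_law r a (B : set R) : uniq r -> \sum_(i <- r) a i ^+ 2 = 1 ->
  measurable B -> P ((fun t => \sum_(i <- r) a i * W i t) @^-1` B) = N01 B.
Proof.
move=> ur a1 mB; pose Y t := \sum_(i <- r) a i * W i t.
have mY : measurable_fun [set: T] Y.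
  by apply: measurable_sum => i; exact: measurable_funM.
have mYB : measurable (Y @^-1` B) by rewrite -[_ @^-1` _]setTI; exact: mY.
rewrite -[LHS]/(P (Y @^-1` B)) -(setIT (Y @^-1` B)) -integral_indic//.
rewrite -[in RHS](setIT B) -integral_indic//.
have mB1 : measurable_fun [set: R] (fun x => (\1_B x : R)%:E).
  by apply/measurable_EFinP; exact: measurable_indic.
rewrite [LHS](ge0_integral_lincomb a ur mB1) => [|x]; last by rewrite lee_fin.
by rewrite a1 sqrtr1; apply: eq_integral => x _; rewrite mul1r.
Qed.

End gaussian_family.

(** * Contraction for exponential moments of maxima *)

Section max_expR.
Context {R : realType} {L : finType}.
Implicit Types (F G : L -> R) (l p : L).

Definition max_expR F : R := \big[Num.max/0]_l expR (F l).

Lemma max_expR_ge0 F : 0 <= max_expR F.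
Proof. exact: bigmax_ge_id. Qed.

Lemma expR_le_max_expR F l : expR (F l) <= max_expR F.
Proof. exact: le_bigmax. Qed.

Lemma max_expR_le F (c : R) : 0 <= c -> (forall l, expR (F l) <= c) -> max_expR F <= c.
Proof. by move=> c0 Fc; apply: bigmax_le. Qed.

Lemma max_expR_eq F l : exists p, max_expR F = expR (F p).
Proof.
have expF0 p : true -> 0 <= expR (F p) by rewrite expR_ge0.
by have [p _ Fp] := @eq_bigmax _ _ _ 0 l xpredT _ isT expF0; exists p.
Qed.

Lemma max_expR_midpoint F G :
  max_expR (fun l => (F l + G l) / 2) <= (max_expR F + max_expR G) / 2.
Proof.
apply: max_expR_le => [|l]; first by rewrite divr_ge0// addr_ge0// max_expR_ge0.
apply: (@le_trans _ _ ((expR (F l) + expR (G l)) / 2)); last first.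
  by rewrite ler_pM2r ?invr_gt0// lerD// expR_le_max_expR.
have sqr_half (x : R) : expR x = expR (x / 2) ^+ 2.
  by rewrite -expRM_natr mulr_natr; congr expR; lra.
rewrite (sqr_half (F l)) (sqr_half (G l)) mulrDl expRD.
by have := sqr_ge0 (expR (F l / 2) - expR (G l / 2)); nra.
Qed.

End max_expR.

Lemma measurable_max_expR (d : measure_display) (T : measurableType d) (R : realType)
    (L : finType) (D : set T) (F : T -> L -> R) :
  (forall l, measurable_fun D (fun t => F t l)) ->
  measurable_fun D (fun t => max_expR (F t)).
Proof.
move=> mF; rewrite /max_expR; elim: index_enum => [|l s IHs].
  by under eq_fun do rewrite big_nil; exact: measurable_cst.
under eq_fun do rewrite big_cons.
by apply: measurable_maxr => //; exact: measurableT_comp.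
Qed.

Lemma measurable_max_expR_pm (d : measure_display) (T : measurableType d) (R : realType)
    (L : finType) (D : set T) (A b : T -> L -> R) :
  (forall l, measurable_fun D (fun t => A t l)) ->
  (forall l, measurable_fun D (fun t => b t l)) ->
  measurable_fun D (fun t => (max_expR (A t \+ b t) + max_expR (A t \- b t)) / 2).
Proof.
move=> mA mb; apply: measurable_funM => //; apply: measurable_funD.
  by apply: measurable_max_expR => l; exact: measurable_funD.
by apply: measurable_max_expR => l; exact: measurable_funB.
Qed.

Definition contraction_of {R : realType} {L : Type} (f b : L -> R) : Prop :=
  (forall l, `|f l| <= `|b l|) /\ (forall p q, `|f p - f q| <= `|b p - b q|).

Section contraction.
Context {R : realType}.

Lemma expR_increment_le (x x' y y' : R) : x <= x' -> x <= y -> x' - x <= y' - y ->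
  expR x' - expR x <= expR y' - expR y.
Proof.
move=> xx' xy xx'yy'.
have incrementE (u v : R) : expR v - expR u = expR u * (expR (v - u) - 1).
  by rewrite mulrBr mulr1 -expRD subrKC.
rewrite !incrementE; apply: ler_pM; rewrite ?expR_ge0 ?subr_ge0 ?ler_expR//.
  by rewrite -expR0 ler_expR subr_ge0.
by rewrite lerD2r ler_expR.
Qed.

Lemma expR_contraction2_ge0 (Ap Aq fp fq bp bq : R) : 0 <= bp -> 0 <= bq ->
  `|fp| <= bp -> `|fq| <= bq -> `|fp - fq| <= `|bp - bq| ->
  Aq + fq <= Ap + fp -> Ap - fp <= Aq - fq ->
  expR (Ap + fp) + expR (Aq - fq) <= expR (Ap + bp) + expR (Aq - bq) \/
  expR (Ap + fp) + expR (Aq - fq) <= expR (Ap - bp) + expR (Aq + bq).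
Proof.
move=> bp0 bq0; rewrite ler_norml => /andP[fp_ge fp_le].
rewrite ler_norml => /andP[fq_ge fq_le] + max_p max_q.
have [bpq|bqp] := leP bq bp.
  rewrite (@ger0_norm _ (bp - bq)) ?subr_ge0// ler_norml => /andP[fpq_ge fpq_le]; left.
  have : expR (Aq - fq) - expR (Aq - bq) <= expR (Ap + bp) - expR (Ap + fp).
    by apply: expR_increment_le; lra.
  by lra.
rewrite (@ltr0_norm _ (bp - bq)) ?subr_lt0// ler_norml => /andP[fpq_ge fpq_le]; right.
have : expR (Ap + fp) - expR (Ap - bp) <= expR (Aq + bq) - expR (Aq - fq).
  by apply: expR_increment_le; lra.
by lra.
Qed.

(* The two-point case of the Ledoux-Talagrand contraction principle. *)
Lemma expR_contraction2 (Ap Aq fp fq bp bq : R) :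
  `|fp| <= `|bp| -> `|fq| <= `|bq| -> `|fp - fq| <= `|bp - bq| ->
  Aq + fq <= Ap + fp -> Ap - fp <= Aq - fq ->
  expR (Ap + fp) + expR (Aq - fq) <= expR (Ap + bp) + expR (Aq - bq) \/
  expR (Ap + fp) + expR (Aq - fq) <= expR (Ap - bp) + expR (Aq + bq).
Proof.
have [bp0|bp0] := lerP 0 bp; have [bq0|bq0] := lerP 0 bq.
- by rewrite (ger0_norm bp0) (ger0_norm bq0); exact: expR_contraction2_ge0.
- rewrite (ger0_norm bp0) (ltr0_norm bq0) !ler_norml.
  move=> /andP[fp_ge fp_le] /andP[fq_ge fq_le] _ _ _; left.
  by apply: lerD; rewrite ler_expR; lra.
- rewrite (ltr0_norm bp0) (ger0_norm bq0) !ler_norml.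
  move=> /andP[fp_ge fp_le] /andP[fq_ge fq_le] _ _ _; right.
  by apply: lerD; rewrite ler_expR; lra.
- rewrite (ltr0_norm bp0) (ltr0_norm bq0) => fp_le fq_le fpq_le max_p max_q.
  have := @expR_contraction2_ge0 Ap Aq fp fq (- bp) (- bq).
  rewrite -opprD normrN !opprK !oppr_ge0 => negated.
  by apply/or_comm; apply: negated => //; exact: ltW.
Qed.

Lemma max_expR_contraction (L : finType) (A f b : L -> R) : contraction_of f b ->
  max_expR (A \+ f) + max_expR (A \- f) <= max_expR (A \+ b) + max_expR (A \- b).
Proof.
move=> [fb fbB]; case: (pickP (@predT L)) => [l0 _|L0]; last first.
  by rewrite /max_expR !big_pred0.
have [p maxp] := max_expR_eq (A \+ f) l0; have [q maxq] := max_expR_eq (A \- f) l0.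
have fqp : A q + f q <= A p + f p.
  by rewrite -ler_expR -[leRHS]maxp (expR_le_max_expR (A \+ f)).
have fpq : A p - f p <= A q - f q.
  by rewrite -ler_expR -[leRHS]maxq (expR_le_max_expR (A \- f)).
have addb l : expR (A l + b l) <= max_expR (A \+ b) by exact: (expR_le_max_expR (A \+ b)).
have subb l : expR (A l - b l) <= max_expR (A \- b) by exact: (expR_le_max_expR (A \- b)).
rewrite maxp maxq /=; have [|] := expR_contraction2 (fb p) (fb q) (fbB p q) fqp fpq.
  by move=> /le_trans; apply; exact: lerD.
by move=> /le_trans; apply; rewrite addrC; exact: lerD.
Qed.

End contraction.

Section symmetrization.
Context {d : measure_display} {T : measurableType d} {R : realType}.
Variable P : probability T R.

Lemma expR_integral_le (X : T -> R) (c : R) :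
  P.-integrable [set: T] (EFin \o X) -> (\int[P]_t (X t)%:E = c%:E)%E ->
  ((expR c)%:E <= \int[P]_t (expR (X t))%:E)%E.
Proof.
move=> intX meanX; have mX : measurable_fun [set: T] X.
  by apply/measurable_EFinP; exact: measurable_int intX.
have mexpX : measurable_fun [set: T] (fun t => (expR (X t))%:E).
  by apply/measurable_EFinP; exact: measurableT_comp.
have [infinite|] := eqVneq (\int[P]_t (expR (X t))%:E)%E +oo%E.
  by rewrite infinite leey.
rewrite -ltey => finite.
have int_expX : P.-integrable [set: T] (fun t => (expR (X t))%:E).
  apply/integrableP; split=> //.
  by under eq_integral do rewrite gee0_abs ?lee_fin ?expR_ge0//.
pose tangent t := (expR c * (1 - c) + expR c * X t)%R.
have int_cst (k : R) : P.-integrable [set: T] (EFin \o cst k).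
  exact: finite_measure_integrable_cst.
have intcX : P.-integrable [set: T] (EFin \o (fun t => expR c * X t)).
  exact: (integrableZl measurableT (expR c) intX).
have -> : (expR c)%:E = (\int[P]_t (tangent t)%:E)%E.
  rewrite [RHS](integralD_EFin measurableT (int_cst (expR c * (1 - c))) intcX).
  rewrite [X in _ = (_ + X)%E](integralZl measurableT intX) meanX /=.
  rewrite integral_cst_probability -EFinM -EFinD.
  by congr EFin; ring.
apply: le_integral => //.
  exact: (integrableD measurableT (int_cst (expR c * (1 - c))) intcX).
move=> t _; rewrite lee_fin /tangent.
have := ler_wpM2l (expR_ge0 c) (expR_ge1Dx (X t - c)).
by rewrite -expRD subrKC; lra.
Qed.

Lemma integral_midpoint (u v : T -> R) :
  measurable_fun [set: T] u -> measurable_fun [set: T] v ->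
  (forall t, 0 <= u t) -> (forall t, 0 <= v t) ->
  (\int[P]_t ((u t + v t) / 2)%:E =
   2^-1%:E * (\int[P]_t (u t)%:E + \int[P]_t (v t)%:E))%E.
Proof.
move=> /measurable_EFinP mu /measurable_EFinP mv u0 v0.
rewrite -ge0_integralD//; last 2 first.
- by move=> t _; rewrite lee_fin.
- by move=> t _; rewrite lee_fin.
rewrite -ge0_integralZl//; last 2 first.
- exact: emeasurable_funD.
- by move=> t _; rewrite adde_ge0 ?lee_fin.
by apply: eq_integral => t _; rewrite -EFinD -EFinM mulrC.
Qed.

Section max_expR_integral.
Variable L : finType.
Implicit Types (A : L -> R) (f b : T -> L -> R).

Lemma measurable_exists_gt f (x : R) :
  (forall l, measurable_fun [set: T] (fun t => f t l)) ->
  measurable [set t | exists l, x < f t l].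
Proof.
move=> mf; rewrite (_ : [set t | _] =
    \bigcup_(l in [set: L]) ((fun t => f t l) @^-1` `]x, +oo[%classic)).
  by apply: fin_bigcup_measurable => // l _; rewrite -[_ @^-1` _]setTI; exact: mf.
apply/seteqP; split => t [l]; first by exists l => //=; rewrite in_itv/= andbT.
by move=> _ /=; rewrite in_itv/= andbT; exists l.
Qed.

Lemma max_expR_markov f (x : R) :
  (forall l, measurable_fun [set: T] (fun t => f t l)) ->
  ((expR x)%:E * P [set t | exists l, (x < f t l)%R] <=
   \int[P]_t (max_expR (f t))%:E)%E.
Proof.
move=> mf; have mmax : measurable_fun [set: T] (fun t => (max_expR (f t))%:E).
  by apply/measurable_EFinP; exact: measurable_max_expR.
have max_abs t : `|(max_expR (f t))%:E|%E = (max_expR (f t))%:E.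
  by rewrite gee0_abs// lee_fin max_expR_ge0.
under eq_integral do rewrite -max_abs.
apply: le_trans (le_integral_abse P measurableT mmax (expR_gt0 x)).
rewrite setTI lee_wpmul2l ?lee_fin ?expR_ge0// le_measure ?inE//.
- exact: measurable_exists_gt.
- rewrite -[X in measurable X]setTI; apply: emeasurable_fun_c_infty => //.
  exact: measurableT_comp.
- move=> t [l xf]; rewrite /= ger0_norm ?max_expR_ge0// lee_fin.
  by apply: le_trans (expR_le_max_expR _ l); rewrite ler_expR ltW.
Qed.

Lemma max_expR_integral_le A f (c : R) :
  (forall l, P.-integrable [set: T] (fun t => (f t l)%:E)) ->
  (forall l, \int[P]_t (f t l)%:E = c%:E)%E ->
  ((max_expR (A \+ cst c))%:E <= \int[P]_t (max_expR (A \+ f t))%:E)%E.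
Proof.
move=> intf meanf; have mf l : measurable_fun [set: T] (fun t => f t l).
  by apply/measurable_EFinP; exact: measurable_int (intf l).
have mAf l : measurable_fun [set: T] (fun t => A l + f t l) by exact: measurable_funD.
case: (pickP (@predT L)) => [l0 _|L0]; last first.
  by rewrite /max_expR big_pred0// integral_ge0// => t _; rewrite lee_fin max_expR_ge0.
have [l ->] := max_expR_eq (A \+ cst c) l0.
apply: (@le_trans _ _ (\int[P]_t (expR (A l + f t l))%:E)%E).
  have intA : P.-integrable [set: T] (EFin \o cst (A l)).
    exact: finite_measure_integrable_cst.
  apply: expR_integral_le; first exact: (integrableD measurableT intA (intf l)).
  rewrite [LHS](integralD_EFin measurableT intA (intf l)).
  by rewrite [X in (_ + X)%E]meanf /= integral_cst_probability.
apply: ge0_le_integral => //.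
- by apply/measurable_EFinP; exact: measurableT_comp.
- by apply/measurable_EFinP; exact: measurable_max_expR.
- by move=> t _; rewrite lee_fin (expR_le_max_expR (A \+ f t)).
Qed.

(* No ghost sample is needed because the mean [c] does not depend on [l]. *)
Lemma max_expR_symmetrization A f (c : R) :
  (forall l, P.-integrable [set: T] (fun t => (f t l)%:E)) ->
  (forall l, \int[P]_t (f t l)%:E = c%:E)%E ->
  (\int[P]_t (max_expR (fun l => A l + (c - f t l) / 2))%:E <=
   \int[P]_t ((max_expR (A \+ f t) + max_expR (A \- f t)) / 2)%:E)%E.
Proof.
move=> intf meanf; have mf l : measurable_fun [set: T] (fun t => f t l).
  by apply/measurable_EFinP; exact: measurable_int (intf l).
have mplus : measurable_fun [set: T] (fun t => max_expR (A \+ f t)).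
  by apply: measurable_max_expR => l; exact: measurable_funD.
have mminus : measurable_fun [set: T] (fun t => max_expR (A \- f t)).
  by apply: measurable_max_expR => l; exact: measurable_funB.
have max0 (F : L -> R) : 0 <= max_expR F by exact: max_expR_ge0.
apply: (@le_trans _ _ (\int[P]_t
    ((max_expR (A \+ cst c) + max_expR (A \- f t)) / 2)%:E)%E).
  apply: ge0_le_integral => //.
  - by move=> t _; rewrite lee_fin.
  - apply/measurable_EFinP; apply: measurable_max_expR => l; apply: measurable_funD => //.
    by apply: measurable_funM => //; exact: measurable_funB.
  - by apply/measurable_EFinP/measurable_funM => //; exact: measurable_funD.
  - move=> t _; rewrite lee_fin.
    rewrite (_ : (fun l => _) = (fun l => ((A \+ cst c) l + (A \- f t) l) / 2)).
      exact: max_expR_midpoint.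
    by apply/funext => l /=; lra.
rewrite !integral_midpoint// lee_wpmul2l ?lee_fin// leeD2r//.
by rewrite integral_cst_probability max_expR_integral_le.
Qed.

Lemma max_expR_symmetrization_contraction A f b (c : R) :
  (forall l, P.-integrable [set: T] (fun t => (f t l)%:E)) ->
  (forall l, \int[P]_t (f t l)%:E = c%:E)%E ->
  (forall l, measurable_fun [set: T] (fun t => b t l)) ->
  (forall t, contraction_of (f t) (b t)) ->
  (\int[P]_t (max_expR (fun l => A l + (c - f t l) / 2))%:E <=
   \int[P]_t ((max_expR (A \+ b t) + max_expR (A \- b t)) / 2)%:E)%E.
Proof.
move=> intf meanf mb fb; apply: (le_trans (max_expR_symmetrization A intf meanf)).
have mf l : measurable_fun [set: T] (fun t => f t l).
  by apply/measurable_EFinP; exact: measurable_int (intf l).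
apply: ge0_le_integral => //.
- by move=> t _; rewrite lee_fin divr_ge0// addr_ge0// max_expR_ge0.
- by apply/measurable_EFinP; exact: measurable_max_expR_pm.
- by apply/measurable_EFinP; exact: measurable_max_expR_pm.
- by move=> t _; rewrite lee_fin ler_pM2r ?invr_gt0// max_expR_contraction.
Qed.

End max_expR_integral.
End symmetrization.

Section independent_symmetrization.
Context {d d' : measure_display} {T : measurableType d} {U : measurableType d'}
  {R : realType} (P : probability T R) (I : finType) (W : I -> {RV P >-> U}) (L : finType).
Local Notation sigma_of J := (g_sigma_algebraType (cylinders W J)).
Hypothesis indepW : mutually_independent W.

Lemma indep_max_expR_symmetrization (J K : pred I) (A f b : T -> L -> R) (c : R) :
  (forall i, J i -> ~~ K i) ->
  (forall l, measurable_fun [set: sigma_of J] (fun t => A t l)) ->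
  (forall l, measurable_fun [set: sigma_of K] (fun t => f t l)) ->
  (forall l, measurable_fun [set: sigma_of K] (fun t => b t l)) ->
  (forall l, P.-integrable [set: T] (fun t => (f t l)%:E)) ->
  (forall l, \int[P]_t (f t l)%:E = c%:E)%E ->
  (forall t, contraction_of (f t) (b t)) ->
  (\int[P]_t (max_expR (fun l => A t l + (c - f t l) / 2))%:E <=
   \int[P]_t ((max_expR (A t \+ b t) + max_expR (A t \- b t)) / 2)%:E)%E.
Proof.
move=> JK mA mf mb intf meanf fb.
have mA1 l : measurable_fun [set: sigma_of J * sigma_of K] (fun x => A x.1 l).
  exact: (measurableT_comp (mA l) measurable_fst).
have msnd (g : T -> L -> R) : (forall l, measurable_fun [set: sigma_of K] (fun t => g t l)) ->
    forall l, measurable_fun [set: sigma_of J * sigma_of K] (fun x => g x.2 l).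
  by move=> mg l; exact: (measurableT_comp (mg l) measurable_snd).
apply: (indep_le_integral (F := fun x => (max_expR (fun l => A x.1 l + (c - f x.2 l) / 2))%:E)
  (G := fun x => ((max_expR (A x.1 \+ b x.2) + max_expR (A x.1 \- b x.2)) / 2)%:E)
  indepW JK).
- apply/measurable_EFinP; apply: measurable_max_expR => l; apply: measurable_funD => //.
  by apply: measurable_funM => //; apply: measurable_funB => //; exact: msnd.
- by apply/measurable_EFinP/measurable_max_expR_pm => //; exact: msnd.
- by move=> x; rewrite lee_fin max_expR_ge0.
- by move=> x; rewrite lee_fin divr_ge0// addr_ge0// max_expR_ge0.
- move=> t; have mbT l := measurable_fun_cylindersW (mb l).
  exact: (max_expR_symmetrization_contraction (A t) intf meanf mbT fb).
Qed.

Lemma eq_integral_max_expR (F G : T -> L -> R) : (forall t l, F t l = G t l) ->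
  (\int[P]_t (max_expR (F t))%:E = \int[P]_t (max_expR (G t))%:E)%E.
Proof. by move=> FG; apply: eq_integral => t _; congr (max_expR _)%:E; exact/funext. Qed.

Section blocks.
Variables (K : finType) (blk : I -> K) (f b : K -> T -> L -> R) (c : R).
Local Notation block k := [pred i | blk i == k].
Hypothesis mf : forall k l, measurable_fun [set: sigma_of (block k)] (fun t => f k t l).
Hypothesis mb : forall k l, measurable_fun [set: sigma_of (block k)] (fun t => b k t l).
Hypothesis intf : forall k l, P.-integrable [set: T] (fun t => (f k t l)%:E).
Hypothesis meanf : forall k l, (\int[P]_t (f k t l)%:E = c%:E)%E.
Hypothesis fb : forall k t, contraction_of (f k t) (b k t).
Implicit Types (A : T -> L -> R) (B : R).

Lemma block_max_expR_sign_bound A B (k : K) :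
  (forall l, measurable_fun [set: sigma_of [pred i | blk i != k]] (fun t => A t l)) ->
  (forall e : bool,
    \int[P]_t (max_expR (fun l => A t l + (-1) ^+ e * b k t l)%R)%:E <= B%:E)%E ->
  (\int[P]_t (max_expR (fun l => A t l + (c - f k t l) / 2)%R)%:E <= B%:E)%E.
Proof.
move=> mA boundB.
have disj i : [pred i | blk i != k] i -> ~~ block k i by [].
apply: le_trans (indep_max_expR_symmetrization disj mA (@mf k) (@mb k)
  (intf k) (meanf k) (fb k)) _.
have mAT l := measurable_fun_cylindersW (mA l).
have mbT l := measurable_fun_cylindersW (@mb k l).
rewrite integral_midpoint; last 4 first.
- by apply: measurable_max_expR => l; exact: measurable_funD.
- by apply: measurable_max_expR => l; exact: measurable_funB.
- by move=> t; exact: max_expR_ge0.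
- by move=> t; exact: max_expR_ge0.
have := boundB false; rewrite (eq_integral_max_expR (G := fun t => A t \+ b k t)); last first.
  by move=> t l; rewrite expr0 mul1r.
have := boundB true; rewrite (eq_integral_max_expR (G := fun t => A t \- b k t)); last first.
  by move=> t l; rewrite expr1 mulN1r.
move=> minusB plusB.
have <- : (2^-1%:E * (B%:E + B%:E))%E = B%:E by rewrite -EFinD -EFinM; congr EFin; lra.
by rewrite lee_wpmul2l ?lee_fin// leeD.
Qed.

Lemma blocks_seq_max_expR_signs_bound (s : seq K) A B : uniq s ->
  (forall l, measurable_fun [set: sigma_of [pred i | blk i \notin s]] (fun t => A t l)) ->
  (forall e : K -> bool, \int[P]_t
     (max_expR (fun l => A t l + \sum_(k <- s) (-1) ^+ e k * b k t l)%R)%:E <= B%:E)%E ->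
  (\int[P]_t (max_expR (fun l => A t l + \sum_(k <- s) (c - f k t l) / 2)%R)%:E
    <= B%:E)%E.
Proof.
elim: s A => [|k s IHs] A /=.
  move=> _ _ /(_ (fun=> false)).
  rewrite (eq_integral_max_expR (G := A)) => [|t l]; last by rewrite big_nil addr0.
  by rewrite (eq_integral_max_expR (G := A)) => [//|t l]; rewrite big_nil addr0.
move=> /andP[ks us] mA boundB.
pose centered t l := A t l + \sum_(j <- s) (c - f j t l) / 2.
have centeredE t l : A t l + \sum_(j <- k :: s) (c - f j t l) / 2 =
    centered t l + (c - f k t l) / 2.
  by rewrite /centered big_cons addrCA addrC.
rewrite (eq_integral_max_expR centeredE); apply: block_max_expR_sign_bound => [l|e].
  apply: measurable_funD.
    by apply: measurable_fun_cylindersS (mA l) => i /=; rewrite inE negb_or => /andP[].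
  apply: measurable_sum_seq => j js; apply: measurable_funM => //; apply: measurable_funB => //.
  apply: measurable_fun_cylindersS (@mf j l) => i /= /eqP ->.
  by apply: contra ks => /eqP <-.
pose signed t l := A t l + (-1) ^+ e * b k t l.
have signedE t l : centered t l + (-1) ^+ e * b k t l =
    signed t l + \sum_(j <- s) (c - f j t l) / 2.
  exact: addrAC.
rewrite (eq_integral_max_expR signedE); apply: IHs => [//|l|e_tail].
  apply: measurable_funD.
    by apply: measurable_fun_cylindersS (mA l) => i /=; rewrite inE negb_or => /andP[].
  apply: measurable_funM => //.
  by apply: measurable_fun_cylindersS (@mb k l) => i /= /eqP ->.
pose e_cons j := if j == k then e else e_tail j.
have e_consE t l : signed t l + \sum_(j <- s) (-1) ^+ e_tail j * b j t l =
    A t l + \sum_(j <- k :: s) (-1) ^+ e_cons j * b j t l.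
  rewrite big_cons /e_cons eqxx addrA; congr (_ + _).
  by apply: eq_big_seq => j js; case: eqP js ks => // -> ->.
by rewrite (eq_integral_max_expR e_consE); exact: boundB.
Qed.

Lemma blocks_max_expR_signs_bound B :
  (forall e : K -> bool, \int[P]_t
     (max_expR (fun l => \sum_k (-1) ^+ e k * b k t l)%R)%:E <= B%:E)%E ->
  (\int[P]_t (max_expR (fun l => \sum_k (c - f k t l) / 2)%R)%:E <= B%:E)%E.
Proof.
move=> boundB; have sum_enum (F : K -> T -> L -> R) t l :
    0 + \sum_(k <- enum K) F k t l = \sum_k F k t l by rewrite add0r big_enum.
have := @blocks_seq_max_expR_signs_bound (enum K) (fun _ _ => 0) B (enum_uniq K)
  (fun=> measurable_cst (0 : R)).
rewrite (eq_integral_max_expR (sum_enum (fun k t l => (c - f k t l) / 2))); apply => e.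
by rewrite (eq_integral_max_expR (sum_enum (fun k t l => (-1) ^+ e k * b k t l))).
Qed.

End blocks.
End independent_symmetrization.

(** * Gaussian matrices *)

Section l2norm.
Context {R : realType} {n : nat}.
Implicit Type v : 'cV[R]_n.

Lemma sum_sqr_ge0 v : 0 <= \sum_j v j 0 ^+ 2.
Proof. by apply: sumr_ge0 => j _; exact: sqr_ge0. Qed.

Lemma sqr_l2norm v : l2norm v ^+ 2 = \sum_j v j 0 ^+ 2.
Proof. by rewrite sqr_sqrtr ?sum_sqr_ge0. Qed.

Lemma l2norm_ge0 v : 0 <= l2norm v.
Proof. exact: sqrtr_ge0. Qed.

Lemma l2norm_eq0 v : (l2norm v == 0) = (v == 0).
Proof.
apply/idP/eqP => [|->]; last first.
  by rewrite /l2norm big1 ?sqrtr0// => j _; rewrite mxE expr0n.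
rewrite -sqrf_eq0 sqr_l2norm psumr_eq0 => [/allP sqr0|j _]; last exact: sqr_ge0.
apply/colP => j; rewrite mxE; apply/eqP; rewrite -sqrf_eq0.
exact: sqr0 (mem_index_enum j).
Qed.

Lemma l2normZ (a : R) v : l2norm (a *: v) = `|a| * l2norm v.
Proof.
rewrite /l2norm; under eq_bigr do rewrite mxE exprMn.
by rewrite -mulr_sumr sqrtrM ?sqr_ge0// sqrtr_sqr.
Qed.

Lemma l2norm_delta (j : 'I_n) : l2norm (delta_mx j 0 : 'cV[R]_n) = 1.
Proof.
rewrite /l2norm (bigD1 j)//= mxE !eqxx expr1n big1 ?addr0 ?sqrtr1// => k /negbTE kj.
by rewrite mxE kj expr0n.
Qed.

Lemma continuous_l2norm : continuous (@l2norm R n).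
Proof.
move=> v; apply: continuous_comp; last exact: sqrt_continuous.
apply: (continuous_big add_continuous) => j _ {}v.
apply: (@continuous_comp _ _ _ (fun w : 'cV[R]_n => w j 0) (fun x : R => x ^+ 2)).
  exact: coord_continuous.
exact: sqr_continuous.
Qed.

End l2norm.

Lemma measure_bigcup_le (d : measure_display) (T : measurableType d) (R : realType)
    (mu : {measure set T -> \bar R}) (F : (set T)^nat) (x : \bar R) :
  (forall k, measurable (F k)) -> (forall k, mu (\bigcup_(l < k) F l) <= x)%E ->
  (mu (\bigcup_k F k) <= x)%E.
Proof.
move=> mF Fx; pose G k := \bigcup_(l < k) F l.
have mG k : measurable (G k) by exact: bigcup_measurable.
have -> : \bigcup_k F k = \bigcup_k G k.
  apply/seteqP; split=> t [k _ Fkt]; last by case: Fkt => l _ Flt; exists l.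
  by exists k.+1 => //; exists k => /=.
have ndG : {homo G : k l / (k <= l)%N >-> (k <= l)%O}.
  by move=> k l kl; apply/subsetPset => t [j /= jk Fjt]; exists j => //=; exact: leq_trans kl.
have cvgG := nondecreasing_cvg_mu (mu := mu) mG (bigcupT_measurable _ mG) ndG.
rewrite -(cvg_lim _ cvgG)//; apply: lime_le; first exact: cvgP cvgG.
by apply: nearW => k; exact: Fx.
Qed.

Definition nonexpansive {R : realType} (phi : R -> R) : Prop :=
  forall x y, `|phi x - phi y| <= `|x - y|.

Lemma nonexpansive_measurable (R : realType) (phi : R -> R) :
  nonexpansive phi -> measurable_fun [set: R] phi.
Proof.
move=> phi_le; apply: continuous_measurable_fun => x.
apply/cvgrPdist_le => e e0; near=> y.
apply: le_trans (phi_le _ _) _; near: y; exact: cvgr_dist_le.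
Unshelve. all: by end_near. Qed.

Lemma nonexpansive_contraction_of (R : realType) (L : Type) (phi : R -> R) (a : R)
    (b : L -> R) : nonexpansive phi -> phi 0 = 0 ->
  contraction_of (fun l => a * phi (b l)) (fun l => a * b l).
Proof.
move=> phi_le phi0; split=> [l|p q]; last by rewrite -!mulrBr !normrM ler_wpM2l.
by rewrite !normrM ler_wpM2l//; have := phi_le (b l) 0; rewrite phi0 !subr0.
Qed.

Section gaussian_matrix.
Context {d : measure_display} {T : measurableType d} {R : realType} {m n : nat}
  (P : probability T R) (X : 'I_m -> 'I_n -> {RV P >-> R}).
Local Notation entry p := (X p.1 p.2).
Local Notation Xmx w := (\matrix_(i, j) X i j w).
Local Notation N01 := (normal_prob (0 : R) 1).
Local Notation sigma_of J :=
  (g_sigma_algebraType (cylinders (fun p : 'I_m * 'I_n => entry p) J)).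
Implicit Types (u : 'cV[R]_n) (i : 'I_m) (j : 'I_n) (e : 'I_m -> bool) (w : T).

Hypothesis iidX : iid_std_normal_matrix X.

Lemma entries_mutually_independent :
  mutually_independent (fun p : 'I_m * 'I_n => entry p).
Proof.
move=> B mB; rewrite (_ : [set t | _] = [set t | forall i j, B (i, j) (X i j t)]).
  rewrite (iidX.2 (fun i j => B (i, j)))// pair_bigA/=.
  by apply: eq_bigr => -[i j].
by apply/seteqP; split => w /= Bw; [move=> i j; exact: (Bw (i, j))|move=> [i j]; exact: Bw].
Qed.

Let entry_law (p : 'I_m * 'I_n) (B : set R) :
  measurable B -> P (entry p @^-1` B) = N01 B.
Proof. exact: iidX.1. Qed.

Lemma mulmx_entryE u i :
  (fun w => (Xmx w *m u) i 0) = (fun w => \sum_j u j 0 * X i j w).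
Proof.
by apply/funext => w; rewrite mxE; apply: eq_bigr => j _; rewrite mxE mulrC.
Qed.

Lemma measurable_mulmx_entry_row u i :
  measurable_fun [set: sigma_of [pred p | p.1 == i]] (fun w => (Xmx w *m u) i 0).
Proof.
rewrite mulmx_entryE; apply: measurable_sum => j; apply: measurable_funM => //.
exact: (measurable_fun_cylinders (W := fun p => entry p) (i := (i, j)) (eqxx i)).
Qed.

Lemma measurable_mulmx_entry u i :
  measurable_fun [set: T] (fun w => (Xmx w *m u) i 0).
Proof. exact: measurable_fun_cylindersW (@measurable_mulmx_entry_row u i). Qed.

Lemma mulmx_entry_law u i (B : set R) : l2norm u = 1 -> measurable B ->
  P ((fun w => (Xmx w *m u) i 0) @^-1` B) = N01 B.
Proof.
move=> u1 mB; pose row := [seq (i, j) | j <- enum 'I_n].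
have sum_row (F : 'I_m * 'I_n -> R) : \sum_(p <- row) F p = \sum_j F (i, j).
  by rewrite big_map big_enum.
rewrite mulmx_entryE; have -> : (fun w => \sum_j u j 0 * X i j w) =
    (fun w => \sum_(p <- row) u p.2 0 * entry p w).
  by apply/funext => w; rewrite sum_row.
apply: (unit_lincomb_law entries_mutually_independent entry_law _ _ mB).
- by rewrite map_inj_uniq ?enum_uniq// => j j' [].
- by rewrite sum_row -sqr_l2norm u1 expr1n.
Qed.

Definition sign_col_sum (e : 'I_m -> bool) j w : R :=
  \sum_i (-1) ^+ e i / Num.sqrt m%:R * X i j w.

Lemma sign_col_sum_law e j (B : set R) : (0 < m)%N -> measurable B ->
  P (sign_col_sum e j @^-1` B) = N01 B.
Proof.
move=> m0 mB; pose col := [seq (i, j) | i <- enum 'I_m].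
have sum_col (F : 'I_m * 'I_n -> R) : \sum_(p <- col) F p = \sum_i F (i, j).
  by rewrite big_map big_enum.
have -> : sign_col_sum e j =
    (fun w => \sum_(p <- col) (-1) ^+ e p.1 / Num.sqrt m%:R * entry p w).
  by apply/funext => w; rewrite sum_col.
apply: (unit_lincomb_law entries_mutually_independent entry_law _ _ mB).
- by rewrite map_inj_uniq ?enum_uniq// => i i' [].
- rewrite sum_col; under eq_bigr do rewrite expr_div_n sqrr_sign sqr_sqrtr// div1r.
  by rewrite sumr_const card_ord -[LHS]mulr_natr mulVf// pnatr_eq0 -lt0n.
Qed.

Lemma measurable_sign_col_sum_col e j :
  measurable_fun [set: sigma_of [pred p | p.2 == j]] (sign_col_sum e j).
Proof.
apply: measurable_sum => i; apply: measurable_funM => //.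
exact: (measurable_fun_cylinders (W := fun p => entry p) (i := (i, j)) (eqxx j)).
Qed.

Lemma measurable_sign_col_sum e j : measurable_fun [set: T] (sign_col_sum e j).
Proof. exact: measurable_fun_cylindersW (@measurable_sign_col_sum_col e j). Qed.

Lemma integral_prod_sign_col_sum e : (0 < m)%N ->
  (\int[P]_w (\prod_j expR (sign_col_sum e j w ^+ 2 / 4))%:E =
   (Num.sqrt 2 ^+ n)%:E)%E.
Proof.
move=> m0; pose g j w := expR (sign_col_sum e j w ^+ 2 / 4).
have mg j : measurable_fun [set: sigma_of [pred p | p.2 == j]] (g j).
  apply: measurableT_comp => //; apply: measurable_funM => //; apply: measurable_funX.
  exact: measurable_sign_col_sum_col.
have mean_g j : (\int[P]_w (g j w)%:E = (Num.sqrt 2)%:E)%E.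
  rewrite (ge0_integral_law (nu := N01) (@measurable_sign_col_sum e j)
    (fun B => sign_col_sum_law e j m0) (f := fun x => (expR (x ^+ 2 / 4))%:E)); last 2 first.
  - apply/measurable_EFinP; apply: measurableT_comp => //; exact: measurable_funM.
  - by move=> x; rewrite lee_fin expR_ge0.
  under eq_integral do rewrite mulrC.
  rewrite integral_normal01_expR_sqr; last by lra.
  have -> : 1 - 2 * 4^-1 = 2^-1 :> R by lra.
  by rewrite sqrtrV// invrK.
have := integral_prod_indep (f := snd) entries_mutually_independent (enum_uniq 'I_n) mg
  (fun j w => expR_ge0 _).
under eq_integral do rewrite big_enum/=.
move=> ->; under eq_bigr do rewrite mean_g.
by rewrite big_enum/= prodEFin prodr_const card_ord.
Qed.

(* The left side is sum_j a sqrt(m) u_j G_j with G_j = sign_col_sum e j w; AM-GM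
   bounds each term. *)
Lemma sign_sum_mulmx_le (a : R) e u w : (0 < m)%N -> l2norm u = 1 ->
  \sum_i (-1) ^+ e i * (a * (Xmx w *m u) i 0) <=
  a ^+ 2 * m%:R + \sum_j sign_col_sum e j w ^+ 2 / 4.
Proof.
move=> m0 u1; set r := Num.sqrt (m%:R : R).
have r0 : 0 < r by rewrite sqrtr_gt0 ltr0n.
have -> : a ^+ 2 * m%:R = \sum_j (a * r * u j 0) ^+ 2.
  under eq_bigr do rewrite exprMn.
  by rewrite -mulr_sumr -sqr_l2norm u1 expr1n mulr1 exprMn sqr_sqrtr.
have -> : \sum_i (-1) ^+ e i * (a * (Xmx w *m u) i 0) =
    \sum_j a * r * u j 0 * sign_col_sum e j w.
  under eq_bigr => i _ do rewrite [(_ *m _) _ _](congr1 (@^~ w) (mulmx_entryE u i)) !mulr_sumr.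
  rewrite exchange_big/=; apply: eq_bigr => j _; rewrite mulr_sumr.
  by apply: eq_bigr => i _; rewrite -/r; field; rewrite gt_eqF.
rewrite -big_split/=; apply: ler_sum => j _.
by have := sqr_ge0 (a * r * u j 0 - sign_col_sum e j w / 2); lra.
Qed.

Section unit_family.
Variables (L : finType) (u : L -> 'cV[R]_n).
Hypothesis u1 : forall l, l2norm (u l) = 1.

Lemma sign_sum_mgf_le (a : R) e : (0 < m)%N ->
  (\int[P]_w
     (max_expR (fun l => \sum_i (-1) ^+ e i * (a * (Xmx w *m u l) i 0))%R)%:E <=
   (expR (a ^+ 2 * m%:R) * Num.sqrt 2 ^+ n)%:E)%E.
Proof.
move=> m0; have mprod : measurable_fun [set: T]
    (fun w => \prod_j expR (sign_col_sum e j w ^+ 2 / 4)).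
  apply: measurable_prod => j _; apply: measurableT_comp => //.
  apply: measurable_funM => //; apply: measurable_funX.
  exact: measurable_sign_col_sum.
rewrite EFinM -(integral_prod_sign_col_sum e m0) -ge0_integralZl//; last 2 first.
- exact/measurable_EFinP.
- by move=> w _; rewrite lee_fin prodr_ge0// => j _; exact: expR_ge0.
apply: ge0_le_integral => //.
- by move=> w _; rewrite lee_fin max_expR_ge0.
- apply/measurable_EFinP; apply: measurable_max_expR => l.
  apply: measurable_sum => i; apply: measurable_funM => //; apply: measurable_funM => //.
  exact: measurable_mulmx_entry.
- by apply: emeasurable_funM => //; exact/measurable_EFinP.
- move=> w _; rewrite -EFinM lee_fin -expR_sum -expRD.
  apply: max_expR_le => [|l]; first exact: expR_ge0.
  by rewrite ler_expR sign_sum_mulmx_le.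
Qed.

Variables (phi : R -> R) (c : R).
Hypothesis phi0 : phi 0 = 0.
Hypothesis phi_le : nonexpansive phi.
Hypothesis phi_mean : (\int[N01]_x (phi x)%:E = c%:E)%E.

Let integrable_phi : N01.-integrable [set: R] (EFin \o phi).
Proof.
apply: (le_integrable measurableT _ _ integrable_normal01_id).
  by apply/measurable_EFinP; exact: nonexpansive_measurable.
by move=> x _; rewrite lee_fin; have := phi_le x 0; rewrite phi0 !subr0.
Qed.

Lemma nonexpansive_sum_mgf_le (a : R) : (0 < m)%N ->
  (\int[P]_w (max_expR (fun l => \sum_i (a * c - a * phi ((Xmx w *m u l) i 0)) / 2)%R)%:E <=
   (expR (a ^+ 2 * m%:R) * Num.sqrt 2 ^+ n)%:E)%E.
Proof.
move=> m0; have mrow l i := @measurable_mulmx_entry (u l) i.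
have mphirow l i : measurable_fun [set: sigma_of [pred p | p.1 == i]]
    (fun w => phi ((Xmx w *m u l) i 0)).
  apply: (measurableT_comp (nonexpansive_measurable phi_le)).
  exact: measurable_mulmx_entry_row.
have law_row l i B := @mulmx_entry_law (u l) i B (u1 l).
have int_phirow l i := integrable_law (nu := N01) (mrow l i) (law_row l i) integrable_phi.
apply: (blocks_max_expR_signs_bound entries_mutually_independent (blk := fst)
  (f := fun i w l => a * phi ((Xmx w *m u l) i 0))
  (b := fun i w l => a * (Xmx w *m u l) i 0)) => [i l|i l|i l|i l|i w|e].
- exact: measurable_funM.
- by apply: measurable_funM => //; exact: measurable_mulmx_entry_row.
- exact: (integrableZl measurableT a (int_phirow l i)).
- rewrite [LHS](integralZl measurableT (int_phirow l i)).
  rewrite (integral_law (nu := N01) (mrow l i) (law_row l i) integrable_phi).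
  by rewrite phi_mean EFinM.
- exact: nonexpansive_contraction_of.
- exact: sign_sum_mgf_le.
Qed.

Lemma nonexpansive_sum_finite_lower_tail (delta : R) : (0 < m)%N -> 0 < delta ->
  (P [set w | exists l, (\sum_i phi ((Xmx w *m u l) i 0) < m%:R * (c - delta))%R] <=
   (expR (- (delta ^+ 2 * m%:R) / 16) * Num.sqrt 2 ^+ n)%:E)%E.
Proof.
(* [delta / 4] minimises [a ^+ 2 - a * delta / 2]. *)
move=> m0 delta0; pose a := delta / 4; have a0 : 0 < a by rewrite divr_gt0.
pose f w l := \sum_i (a * c - a * phi ((Xmx w *m u l) i 0)) / 2.
pose x := delta ^+ 2 * m%:R / 8.
have mf l : measurable_fun [set: T] (fun w => f w l).
  apply: measurable_sum => i; apply: measurable_funM => //; apply: measurable_funB => //.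
  apply: measurable_funM => //; apply: (measurableT_comp (nonexpansive_measurable phi_le)).
  exact: measurable_mulmx_entry.
have x_lt_f w l : (x < f w l) = (\sum_i phi ((Xmx w *m u l) i 0) < m%:R * (c - delta)).
  rewrite /f -mulr_suml sumrB sumr_const card_ord -mulr_sumr -[_ *+ m]mulr_natr.
  set S := \sum_i _; have -> : x = a / 2 * (m%:R * delta) by rewrite /x /a; field.
  have -> : (a * c * m%:R - a * S) / 2 = a / 2 * (m%:R * c - S) by field.
  by rewrite ltr_pM2l ?divr_gt0//; apply/idP/idP; lra.
under eq_set => w do under eq_exists => l do rewrite -x_lt_f.
have := le_trans (max_expR_markov P x mf) (nonexpansive_sum_mgf_le a m0).
have /fineK <- : P [set w | exists l, x < f w l] \is a fin_num.
  by apply: fin_num_measure; exact: measurable_exists_gt.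
rewrite -EFinM !lee_fin -ler_pdivlMl ?expR_gt0// mulrA -expRN -expRD => /le_trans; apply.
by apply/ler_wpM2r; [rewrite exprn_ge0|rewrite ler_expR /x /a; lra].
Qed.

End unit_family.

Definition lower_tail (u : nat -> 'cV[R]_n) (phi : R -> R) (x : R) : set T :=
  \bigcup_k [set w | \sum_i phi ((Xmx w *m u k) i 0) < m%:R * x].

Lemma nonexpansive_sum_lower_tail (u : nat -> 'cV[R]_n) (phi : R -> R) (c delta : R) :
  (forall k, l2norm (u k) = 1) ->
  phi 0 = 0 -> nonexpansive phi ->
  (\int[N01]_x (phi x)%:E = c%:E)%E -> (0 < m)%N -> 0 < delta ->
  measurable (lower_tail u phi (c - delta)) /\
  (P (lower_tail u phi (c - delta)) <=
   (expR (- (delta ^+ 2 * m%:R) / 16) * Num.sqrt 2 ^+ n)%:E)%E.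
Proof.
move=> u1 phi0 phi_le phi_mean m0 delta0.
pose tail k := [set w | \sum_i phi ((Xmx w *m u k) i 0) < m%:R * (c - delta)].
have mtail k : measurable (tail k).
  rewrite -[tail k]preimage_itvNyo -[_ @^-1` _]setTI.
  suff : measurable_fun [set: T] (fun w => \sum_i phi ((Xmx w *m u k) i 0)) by exact.
  apply: measurable_sum => i; apply: (measurableT_comp (nonexpansive_measurable phi_le)).
  exact: measurable_mulmx_entry.
split; first exact: bigcupT_measurable.
apply: measure_bigcup_le => // k.
rewrite (_ : \bigcup_(l < k) tail l = [set w | exists l : 'I_k, tail l w]); last first.
  by apply/seteqP; split => w [l]; [move=> /= lk tw; exists (Ordinal lk)|exists l => /=].
exact: (nonexpansive_sum_finite_lower_tail (u := fun l : 'I_k => u l)).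
Qed.

End gaussian_matrix.

(** * Deterministic recovery *)

Lemma continuous_ge0_ratr {R : realType} {m n : nat} (F : 'M[R]_(m, n) -> R) :
  continuous F -> (forall v : 'M[rat]_(m, n), 0 <= F (map_mx ratr v)) ->
  forall v, 0 <= F v.
Proof.
move=> cF F0 v.
have closedF : closed (F @^-1` [set x | 0 <= x]).
  by apply: preimage_closed => [w _|]; [exact: cF|exact: closed_ge].
apply: closedF => V /nbhs_ballP[e /= e0 eV].
have /fin_all_exists2[q _ vq] : forall ij : 'I_m * 'I_n,
    exists2 q : rat, true & ball (v ij.1 ij.2) e (ratr q).
  move=> ij; have /rat_in_itvoo[q qv] : v ij.1 ij.2 - e < v ij.1 ij.2 + e by lra.
  by exists q => //; rewrite ball_itv.
exists (map_mx ratr (\matrix_(i, j) q (i, j))); split; first exact: F0.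
by apply: eV; split=> // i j; rewrite !mxE; exact: vq (i, j).
Qed.

Section rat_direction.
Context {R : realType} {n : nat}.

Definition rat_direction (k : nat) : 'cV[R]_n.+1 :=
  let v := map_mx ratr (odflt 0 (unpickle k) : 'cV[rat]_n.+1) in
  if v == 0 then delta_mx 0 0 else (l2norm v)^-1 *: v.

Lemma l2norm_rat_direction k : l2norm (rat_direction k) = 1.
Proof.
rewrite /rat_direction; set v := map_mx _ _; case: ifPn => [_|v0].
  exact: l2norm_delta.
rewrite l2normZ normfV ger0_norm ?l2norm_ge0// mulVf//.
by rewrite l2norm_eq0.
Qed.

Lemma homogeneous_ge0_rat_direction (F : 'cV[R]_n.+1 -> R) : continuous F ->
  (forall a v, 0 <= a -> F (a *: v) = a * F v) ->
  (forall k, 0 <= F (rat_direction k)) -> forall v, 0 <= F v.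
Proof.
move=> cF homF F0; apply: continuous_ge0_ratr => // q.
have := F0 (pickle q); rewrite /rat_direction pickleK /=; case: eqVneq => [-> _|v0].
  by rewrite -(scale0r (0 : 'cV[R]_n.+1)) homF// mul0r.
by rewrite homF ?invr_ge0 ?l2norm_ge0// pmulr_rge0 ?invr_gt0 ?lt0r ?l2norm_eq0 ?v0 ?l2norm_ge0.
Qed.

End rat_direction.

Section fold_norm.
Context {R : realType}.
Implicit Types t x y : R.

Definition fold_norm t x : R := Num.min `|x| (2 * t - `|x|).

Lemma fold_normE t x : fold_norm t x = `|x| - 2 * Num.max (`|x| - t) 0.
Proof.
rewrite /fold_norm.
by have [?|?] := leP `|x| (2 * t - `|x|); have [?|?] := leP (`|x| - t) 0; lra.
Qed.

Lemma fold_norm0 t : 0 <= t -> fold_norm t 0 = 0.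
Proof. by move=> t0; rewrite /fold_norm normr0 subr0 min_l ?mulr_ge0. Qed.

Lemma nonexpansive_fold_norm t : nonexpansive (fold_norm t).
Proof.
move=> x y; apply: le_trans (ler_dist_dist x y); rewrite /fold_norm.
move: `|x| `|y| => a b; rewrite ler_norml.
by have [?|?] := leP a (2 * t - a); have [?|?] := leP b (2 * t - b);
  have [?|?] := lerP b a; apply/andP; split; lra.
Qed.

(* At the threshold sqrt (2 log 2) the normal density is half its value at 0, so
   the two density terms cancel. *)
Lemma integral_normal01_fold_norm (t := Num.sqrt (2 * ln 2) : R) :
  (\int[normal_prob 0%R 1%R]_x (fold_norm t x)%:E = (2 * t * eta0)%:E)%E.
Proof.
have ln20 : 0 <= ln (2 : R) by rewrite ln_ge0// ler1n.
have t0 : 0 <= t by exact: sqrtr_ge0.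
have pdf_t : normal_pdf 0 1 t = normal_pdf 0 1 0 / 2.
  rewrite !normal_pdfE ?oner_neq0// -mulrA; congr (_ * _).
  rewrite /normal_fun !subr0 sqr_sqrtr; last by rewrite mulr_ge0.
  rewrite expr0n oppr0 mul0r expR0 mul1r expr1n -[RHS]lnK ?posrE// lnV ?posrE//.
  by congr expR; lra.
have mexcess : measurable_fun [set: R] (fun x => Num.max (`|x| - t) 0).
  by apply: measurable_maxr => //; exact: measurable_funB.
have int_excess : (normal_prob 0 1).-integrable [set: R]
    (fun x => (Num.max (`|x| - t) 0)%:E).
  apply/integrableP; split; first exact/measurable_EFinP.
  under eq_integral do rewrite gee0_abs ?lee_fin ?le_max ?lexx ?orbT//.
  by rewrite integral_normal01_excess_norm// ltry.
have int_double_excess := integrableZl measurableT 2 int_excess.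
have int_norm : (normal_prob 0 1).-integrable [set: R] (fun x => `|x|%:E).
  exact: integrable_norm integrable_normal01_id.
under eq_integral do rewrite fold_normE EFinB EFinM.
rewrite (integralB measurableT int_norm int_double_excess).
rewrite (integralZl measurableT int_excess) integral_normal01_excess_norm//.
by rewrite integral_normal01_norm -EFinM -EFinB pdf_t /eta0; congr EFin; field.
Qed.

End fold_norm.

Section l1_gap.
Context {R : realType} {m : nat}.
Implicit Types (z v : 'cV[R]_m) (t a : R).

Definition l1_gap z v : R :=
  \sum_(i | z i 0 == 0) `|v i 0| - \sum_(i | z i 0 != 0) `|v i 0|.

Lemma l1_gapE z v : l1_gap z v = \sum_i (-1) ^+ (z i 0 != 0) * `|v i 0|.
Proof.
rewrite (bigID (fun i => z i 0 == 0))/= /l1_gap -sumrN.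
by congr (_ + _); apply: eq_bigr => i; [move=> ->|move=> ->]; rewrite ?mul1r ?mulN1r.
Qed.

Lemma l1_gapZ z v a : 0 <= a -> l1_gap z (a *: v) = a * l1_gap z v.
Proof.
move=> a0; rewrite !l1_gapE mulr_sumr; apply: eq_bigr => i _.
by rewrite mxE normrM ger0_norm// mulrCA.
Qed.

Lemma continuous_mulmx_entry n (A : 'M[R]_(m, n)) i :
  continuous (fun h : 'cV[R]_n => (A *m h) i 0).
Proof.
rewrite (_ : (fun h => _) = (fun h : 'cV[R]_n => \sum_j A i j * h j 0)); last first.
  by apply/funext => h; rewrite mxE.
apply: (continuous_big add_continuous) => j _ h.
apply: (@continuous_comp _ _ _ (fun h : 'cV[R]_n => h j 0) ( *%R (A i j))).
  exact: coord_continuous.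
exact: mulrl_continuous.
Qed.

Lemma continuous_l1_gap_mulmx n (A : 'M[R]_(m, n)) z :
  continuous (fun h : 'cV[R]_n => l1_gap z (A *m h)).
Proof.
have cabs i : continuous (fun h : 'cV[R]_n => `|(A *m h) i 0|).
  move=> h; apply: (@continuous_comp _ _ _ (fun h : 'cV[R]_n => (A *m h) i 0) Num.norm).
    exact: continuous_mulmx_entry.
  exact: norm_continuous.
have csum (Q : pred 'I_m) :
    continuous (fun h : 'cV[R]_n => \sum_(i | Q i) `|(A *m h) i 0|).
  by apply: (continuous_big add_continuous) => i _; exact: cabs.
move=> h; exact: (cvgB (csum (fun i => z i 0 == 0) h) (csum (fun i => z i 0 != 0) h)).
Qed.

Lemma l0normE z : (l0norm z)%:R = \sum_i (z i 0 != 0)%:R :> R.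
Proof.
rewrite /l0norm -sum1_card natr_sum big_mkcond/=; apply: eq_bigr => i _.
rewrite [_ \in _](_ : _ = (z i 0 != 0)); last exact: asboolb.
by case: (z i 0 != 0).
Qed.

Lemma fold_norm_sum_le_l1_gap t z v :
  \sum_i fold_norm t (v i 0) - 2 * t * (l0norm z)%:R <= l1_gap z v.
Proof.
rewrite l0normE l1_gapE mulr_sumr -sumrB; apply: ler_sum => i _.
case: (z i 0 != 0); rewrite ?mulr1 ?mulr0 ?subr0 ?mul1r ?mulN1r.
  by rewrite lerBlDr addrC ge_min lexx orbT.
by rewrite ge_min lexx.
Qed.

Lemma l1_argmin_gap n (A : 'M[R]_(m, n)) (ws wh : 'cV[R]_n) (dv z : 'cV[R]_m) :
  is_l1_argmin A (A *m ws + dv + z) wh ->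
  l1_gap z (A *m (wh - ws)) <= 2 * l1norm dv.
Proof.
move=> /(_ ws); rewrite l1_gapE /l1norm mulr_sumr -subr_ge0 => argmin.
rewrite -subr_ge0 -sumrB; apply: (le_trans argmin); rewrite -sumrB; apply: ler_sum => i _.
have -> : (A *m ws + dv + z - A *m ws) i 0 = dv i 0 + z i 0.
  by rewrite !mxE; ring.
have -> : (A *m ws + dv + z - A *m wh) i 0 = dv i 0 + z i 0 - (A *m (wh - ws)) i 0.
  by rewrite mulmxBr !mxE; ring.
move: ((A *m (wh - ws)) i 0) (dv i 0) => g x.
have [->|z0] /= := eqVneq (z i 0) 0.
  by rewrite addr0; have := lerB_dist g x; rewrite distrC; lra.
by have := lerB_dist (x + z i 0) g; have := normr_ge0 x; lra.
Qed.

End l1_gap.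

Lemma robust_l1_property_cV0 {R : realType} {m : nat} (A : 'M[R]_(m, 0)) (eta eps K : R) :
  0 <= eps -> 0 <= K -> robust_l1_property A eta eps K.
Proof.
move=> eps0 K0 ws z dv _ wh _; rewrite /l2norm big_ord0 sqrtr0.
by rewrite divr_ge0 ?mulr_ge0// sumr_ge0.
Qed.

Lemma robust_l1_property_rat_direction {R : realType} {m n : nat}
    (A : 'M[R]_(m, n.+1)) (t eps eta : R) :
  (0 < m)%N -> 1 <= t -> 0 < eps -> eta < eta0 - eps ->
  (forall k, m%:R * (2 * t * eta0 - t * eps) <=
     \sum_i fold_norm t ((A *m rat_direction k) i 0)) ->
  robust_l1_property A eta eps 2.
Proof.
move=> m0 t1 eps0 eta_lt fold_ge ws z dv z_sparse wh argmin.
have mR : 0 < m%:R :> R by rewrite ltr0n.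
pose kappa := t * eps * m%:R.
pose F (h : 'cV[R]_n.+1) := l1_gap z (A *m h) - kappa * l2norm h.
have cF : continuous F.
  move=> h; apply: (cvgB (@continuous_l1_gap_mulmx R m n.+1 A z h)).
  exact: (continuous_comp (@continuous_l2norm R n.+1 h) (@mulrl_continuous R kappa _)).
have homF a h : 0 <= a -> F (a *: h) = a * F h.
  by move=> a0; rewrite /F -scalemxAr l1_gapZ// l2normZ ger0_norm//; ring.
have F0 k : 0 <= F (rat_direction k).
  rewrite /F l2norm_rat_direction mulr1 /kappa.
  have := fold_norm_sum_le_l1_gap t z (A *m rat_direction k); have := fold_ge k.
  have : 0 <= 2 * t * (eta * m%:R - (l0norm z)%:R).
    by rewrite mulr_ge0 ?subr_ge0// mulr_ge0//; lra.
  have : 0 <= (2 * t * m%:R) * (eta0 - eps - eta) by rewrite !mulr_ge0//; lra.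
  by lra.
have := homogeneous_ge0_rat_direction cF homF F0 (wh - ws); rewrite /F subr_ge0.
move=> /le_trans/(_ (l1_argmin_gap argmin)) kappa_le.
rewrite ler_pdivlMr ?mulr_gt0//; apply: le_trans kappa_le.
by rewrite mulrC ler_wpM2r ?l2norm_ge0// /kappa -mulrA ler_peMl// mulr_ge0// ltW.
Qed.

Section constants.
Context {R : realType}.

Lemma sqrt_2ln2_ge1 : 1 <= Num.sqrt (2 * ln 2) :> R.
Proof.
have ln2_ge_half : 2^-1 <= ln (2 : R).
  rewrite -ler_expR lnK ?posrE//.
  have := expR_ge1Dx (- 2^-1 : R); have := expRxMexpNx_1 (2^-1 : R).
  by have := expR_gt0 (2^-1 : R); nra.
by rewrite -[leLHS]sqrtr1 ler_wsqrtr//; lra.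
Qed.

Lemma sqrt2_le_expR_half : Num.sqrt 2 <= expR 2^-1 :> R.
Proof.
apply: le_trans (expR_ge1Dx _).
rewrite -[leRHS]ger0_norm; last by lra.
by rewrite -sqrtr_sqr ler_wsqrtr//; lra.
Qed.

Lemma lower_tail_bound_le (t eps : R) (m n : nat) : 1 <= t -> 0 < eps ->
  16 * n%:R / eps ^+ 2 < m%:R ->
  expR (- ((t * eps) ^+ 2 * m%:R) / 16) * Num.sqrt 2 ^+ n <=
  expR (- (eps ^+ 2 * m%:R) / 32).
Proof.
move=> t1 eps0; rewrite ltr_pdivrMr ?exprn_gt0// => mn.
have sqrt2n : Num.sqrt 2 ^+ n <= expR (2^-1 * n%:R) :> R.
  by rewrite expRM_natr lerXn2r ?nnegrE ?sqrtr_ge0 ?expR_ge0// sqrt2_le_expR_half.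
apply: (le_trans (ler_wpM2l (expR_ge0 _) sqrt2n)); rewrite -expRD ler_expR.
have : 0 <= eps ^+ 2 * m%:R * (t ^+ 2 - 1).
  by rewrite mulr_ge0 ?subr_ge0 ?exprn_ege1// mulr_ge0 ?sqr_ge0.
by lra.
Qed.

End constants.

Theorem theorem1p2 :
  exists (C K N : nat), (0 < C)%N /\ (0 < K)%N /\ (0 < N)%N /\
  forall (R : realType) (eps eta : R) (m n : nat),
    0 < eps -> eta < eta0 - eps ->
    C%:R * n%:R / eps ^+ 2 < m%:R ->
    forall (d : measure_display) (T : measurableType d) (P : probability T R)
           (X : 'I_m -> 'I_n -> {RV P >-> R}),
      @iid_std_normal_matrix d T R P m n X ->
      exists E : set T,
        measurable E /\
        E `<=` [set t | robust_l1_property (\matrix_(i, j) X i j t) eta eps K%:R] /\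
        ((1 - expR (- (eps ^+ 2 * m%:R) / N%:R))%:E <= P E)%E.
Proof.
exists 16%N, 2%N, 32%N; do 3 split=> //.
move=> R eps eta m [|n] eps0 eta_lt mn d T P X iidX.
  exists setT; split; first exact: measurableT.
  split; first by move=> w _; apply: robust_l1_property_cV0 => //; exact: ltW.
  by rewrite probability_setT lee_fin lerBlDr lerDl expR_ge0.
have m0 : (0 < m)%N.
  by rewrite -(ltr0n R); apply: le_lt_trans mn; rewrite divr_ge0 ?sqr_ge0// mulr_ge0.
pose t : R := Num.sqrt (2 * ln 2); have t1 : 1 <= t := sqrt_2ln2_ge1.
have [mtail Ptail] := nonexpansive_sum_lower_tail iidX l2norm_rat_direction
  (fold_norm0 (sqrtr_ge0 _)) (@nonexpansive_fold_norm R t) integral_normal01_fold_norm m0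
  (mulr_gt0 (lt_le_trans ltr01 t1) eps0).
exists (~` lower_tail X rat_direction (fold_norm t) (2 * t * eta0 - t * eps)).
split; first exact: measurableC; split.
  move=> w not_tail; apply: (robust_l1_property_rat_direction m0 t1 eps0 eta_lt) => k.
  by rewrite leNgt; apply/negP => tail_k; apply: not_tail; exists k.
rewrite probability_setC// EFinB leeB//; apply: le_trans Ptail _.
by rewrite lee_fin lower_tail_bound_le.
Qed.
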